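(* For every $\gamma\in(0,1)$ there exists $\epsilon=\epsilon(\gamma)>0$ such that the following holds. Let $p$ be a sufficiently large prime, let $P=A\times B\subseteq(\mathbb{F}_p^2\times\mathbb{F}_p^2)\setminus\{(0,0,0,0)\}$, and let $S$ be a symmetric subset of $SL_2(\mathbb{F}_p)$ with $p^\gamma<|S|<p^{3-2\gamma}$ and $|S\cap gH|<p^{-\gamma/2}|S|$ for every proper subgroup $H\subsetneq SL_2(\mathbb{F}_p)$ and every $g\in SL_2(\mathbb{F}_p)$. Then \[I(P,S)\ll\frac{|A|^{1/2}|B||S|}{p}+p^{\frac{2-\epsilon}{4}}|A|^{1/2}|B|^{1/2}|S|^{3/4}.\] Moreover, if every line through the origin contains at most $k$ points of $B$, then \[I(P,S)\ll\frac{|A|^{1/2}|B||S|}{p}+k^{1/4}p^{\frac{1-\epsilon}{4}}|A|^{1/2}|B|^{1/2}|S|^{3/4}.\]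
   Context: $S$ symmetric means $S=S^{-1}$. $I(P,S)$ is the number of pairs $((x,y),\theta)\in P\times S$ with $\theta y=x$ (matrices acting on column vectors). A line through the origin is a one-dimensional subspace of $\mathbb{F}_p^2$. $X\ll Y$ means $X\le CY$ for a constant $C$ independent of $p,A,B,S,k$. *)

(* Defs.v *)
From HB Require Import structures.
From mathcomp Require Import all_boot all_order all_fingroup all_algebra.
From mathcomp Require Import reals exp.

Set Implicit Arguments.
Unset Strict Implicit.
Unset Printing Implicit Defensive.

Import GroupScope GRing.Theory.
Local Open Scope ring_scope.

Section SpecialLinear.
Variable p : nat.

(* 'F_p is the field with p elements only when p is prime. *)
Definition SL2 : {set {'GL_2(p)}} := [set g | \det (GLval g) == 1].

Lemma SL2_group_set : group_set SL2.
Proof.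
apply/group_setP; split=> [|g h]; first by rewrite inE GL_1E det1.
by rewrite !inE GL_MxE det_mulmx => /eqP-> /eqP->; rewrite mulr1.
Qed.

Canonical SL2_group := Group SL2_group_set.

Definition incidences (P : {set 'cV['F_p]_2 * 'cV['F_p]_2})
    (S : {set {'GL_2(p)}}) : nat :=
  #|[set q in setX P S | GLval q.2 *m q.1.2 == q.1.1]|.

End SpecialLinear.

(* Main.v *)
Require Import Defs.
From mathcomp Require Import all_boot all_order all_fingroup all_algebra.
From mathcomp Require Import reals exp.
From mathcomp Require Import zify ring lra.

(* Cauchy-Schwarz over [A] bounds the square of the number of incidences by
   [|A| sum_g r g * N g], where [r g] counts the representations of [g] as a
   quotient of two elements of [S] and [N g] the vectors [y] of [B] with [g y] in
   [B].  The mean of [N] over SL_2 gives the main term, its variance is at most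
   [3 k p |B|^2] (a second moment computation with determinants), so a second
   Cauchy-Schwarz reduces everything to a power saving over the trivial bound
   [|S|^3] for the multiplicative energy [sum_g r g ^ 2].  If the energy were
   large, the Balog-Szemeredi-Gowers argument would give an approximate group of
   size comparable to [|S|], one coset of which contains a large part of [S].  By
   the non-concentration hypothesis it generates SL_2, which contradicts
   Helfgott's product theorem.

   The product theorem is proved by the pivot argument: a conjugacy class meets
   an approximate group [A] in at most about [|A|^(2/3)] elements, so a maximal
   torus containing one regular element of [A^2] contains about [|A|^(1/3)] of
   them; this property is inherited by conjugates under [A], hence by all
   conjugates, and there are about [p^2] of them, so [|A|] is close to [p^3]. *)

Set Implicit Arguments.
Unset Strict Implicit.
Unset Printing Implicit Defensive.

Import Order.TTheory GRing.Theory Num.Theory.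
Local Open Scope ring_scope.

(** * Multiplicative energy and the Balog-Szemeredi-Gowers theorem *)

(** Two obstacles shape the argument. Balog-Szemeredi-Gowers bounds only [A^-1 * A], which in a
    nonabelian group controls neither [A * A^-1] nor longer products; one therefore passes to the
    popular elements of [A * A^-1], all of whose powers are small. The class bound, in turn, is
    proved for traces other than 0, 2 and -2: its proof cancels the trace and needs one-dimensional
    eigenspaces. Hence a bounded power of the generating set must be shown to contain an element of
    good trace, which uses that 2 and 3 are nonzero in the field, and each torus count loses up to 6
    elements. Every loss is a fixed power of the energy parameter [K], up to a constant; so with [K]
    about p^eps and eps a small multiple of gamma, the losses stay below the margin p^(gamma/2) that
    the hypotheses on [S] provide. *)

Lemma Cauchy_Schwarz_sum (R : realDomainType) (I : finType) (P : pred I)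
    (f g : I -> R) :
  (\sum_(i | P i) f i * g i) ^+ 2 <=
  (\sum_(i | P i) f i ^+ 2) * (\sum_(i | P i) g i ^+ 2).
Proof.
rewrite -(ler_pMn2r (n := 2)) // expr2 !big_distrlr /=.
rewrite [leRHS]mulr2n [X in _ <= _ + X]exchange_big -big_split -sumrMnl /=.
apply: ler_sum => i _; rewrite -big_split -sumrMnl /=.
apply: ler_sum => j _; rewrite -subr_ge0.
apply: le_trans (sqr_ge0 (f i * g j - f j * g i)) _.
by rewrite le_eqVlt; apply/orP; left; apply/eqP; ring.
Qed.

Lemma sqr_sum_nat (I : finType) (P : pred I) (f : I -> nat) :
  ((\sum_(i | P i) f i) ^ 2 <= #|P| * \sum_(i | P i) f i ^ 2)%N.
Proof.
have := Cauchy_Schwarz_sum P (fun=> 1 : int) (fun i => (f i)%:R).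
rewrite /=; under eq_bigr do rewrite mul1r.
under [X in _ <= X * _]eq_bigr do rewrite expr1n.
under [X in _ <= _ * X]eq_bigr do rewrite -natrX.
by rewrite sumr_const -!natr_sum -natrX -natrM ler_nat.
Qed.

Lemma card_sum_ind (T : finType) (U : {set T}) (Q : pred T) :
  #|[set x in U | Q x]| = (\sum_(x in U) Q x)%N.
Proof.
rewrite -sum1_card big_mkcond [RHS]big_mkcond /=.
by apply: eq_bigr => x _; rewrite inE; case: (x \in U); case: (Q x).
Qed.

Section Energy.
Local Open Scope group_scope.
Local Open Scope nat_scope.
Variable gT : finGroupType.
Implicit Types (A D P S U V Z : {set gT}) (g : gT).

(** Double counting of the pairs [(u, v)], since a pair determines its product [z]. The factor [c]
    keeps lower bounds of the form n/K free of division. *)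
Lemma card_mul_reps U V Z c t :
  {in Z, forall z, t <= c * #|[set u in U | (u^-1 * z)%g \in V]|} ->
  #|Z| * t <= c * (#|U| * #|V|).
Proof.
move=> rep; rewrite -!sum_nat_const.
apply: (@leq_trans (\sum_(z in Z) c * \sum_(u in U) ((u^-1 * z)%g \in V))).
  by apply: leq_sum => z /rep; rewrite card_sum_ind.
rewrite -big_distrr leq_mul2l; apply/orP; right; rewrite exchange_big /=; apply: leq_sum => u _ /=.
rewrite -card_sum_ind -(card_lcoset V u); apply: subset_leq_card.
by apply/subsetP=> z; rewrite inE mem_lcoset => /andP[].
Qed.

Definition reps S g := #|[set a in S | (a * g)%g \in S]|.

Definition energy S := \sum_g reps S g ^ 2.

Lemma reps_le S g : reps S g <= #|S|.
Proof. by apply/subset_leq_card/subsetP => a; rewrite inE => /andP[]. Qed.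

Lemma repsV S g : reps S g^-1 = reps S g.
Proof.
rewrite /reps -(card_rcoset [set a in S | (a * g)%g \in S] g).
apply: eq_card => a; rewrite mem_rcoset !inE mulgKV; exact: andbC.
Qed.

Lemma sum_reps_mul S (f : gT -> nat) :
  \sum_g reps S g * f g = \sum_(a in S) \sum_(b in S) f (a^-1 * b)%g.
Proof.
rewrite (eq_bigr (fun g => \sum_(a in S) ((a * g)%g \in S) * f g)); last first.
  by move=> g _; rewrite /reps card_sum_ind big_distrl.
rewrite exchange_big; apply: eq_bigr => a _ /=.
rewrite [RHS]big_mkcond [RHS](reindex_inj (mulgI a)) /=.
by apply: eq_bigr => g _; rewrite mulKg; case: (_ \in S); rewrite ?mul1n.
Qed.

Lemma sum_reps S (Q : pred gT) :
  \sum_(g | Q g) reps S g = \sum_(a in S) \sum_(b in S) Q (a^-1 * b)%g.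
Proof.
rewrite -(sum_reps_mul S (fun g => Q g : nat)) big_mkcond; apply: eq_bigr => g _.
by case: (Q g); rewrite ?muln1 ?muln0.
Qed.

Lemma sum_reps_all S : \sum_g reps S g = #|S| ^ 2.
Proof. by rewrite sum_reps /= !sum_nat_const muln1. Qed.

(* Balog-Szemeredi-Gowers by dependent random choice, with the popular quotients
   as edges: [A] consists of the vertices of a random neighbourhood [N c] that
   have many common neighbours with most of [N c], so that each element of
   [A^-1 * A] has many representations as a product of four popular quotients. *)
Section BSG.
Variables (S : {set gT}) (K : nat).
Hypothesis energyS : #|S| ^ 3 <= K * energy S.
Hypothesis S_gt0 : 0 < #|S|.

Let n := #|S|.
Let P := [set g | n <= 2 * K * reps S g].
Let conn a b := (a^-1 * b)%g \in P.
Let N c := [set a in S | conn a c].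
Let codeg a b := #|[set c in S | conn a c && conn b c]|.
(** The threshold n/(128 K^2) is set against the factor 8 K^2 of [good_vertex]: at most one pair in
    16 will be bad. *)
Let bad a b := 128 * K ^ 2 * codeg a b < n.

Let conn_sym a b : conn a b = conn b a.
Proof. by rewrite /conn !inE -(repsV S (a^-1 * b)) invMg invgK. Qed.

Let bad_sym a b : bad a b = bad b a.
Proof.
congr (_ * _ < _); apply: eq_card => c.
by rewrite !inE (andbC (conn a c)).
Qed.

Let cardP_le : #|P| <= 2 * K * n.
Proof.
rewrite -(leq_pmul2r S_gt0) -mulnA mulnn -sum_reps_all big_distrr /=.
rewrite -sum_nat_const big_mkcond /=; apply: leq_sum => g _.
by rewrite inE; case: ifP.
Qed.

(** Quotients outside [P] have fewer than n/(2K) representations, so they carry at most half of the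
    energy; on [P] one factor [reps] is bounded by n. *)
Let edges_ge : n ^ 2 <= 2 * K * \sum_(c in S) #|N c|.
Proof.
have -> : \sum_(c in S) #|N c| = \sum_(g in P) reps S g.
  rewrite sum_reps exchange_big; apply: eq_bigr => c _.
  by rewrite /N card_sum_ind.
have le1 : \sum_(g in P) reps S g ^ 2 <= n * \sum_(g in P) reps S g.
  rewrite big_distrr; apply: leq_sum => g _ /=.
  by rewrite expnS expn1 leq_mul2r reps_le orbT.
have le2 : 2 * K * \sum_(g | g \notin P) reps S g ^ 2 <= n ^ 3.
  rewrite expnS -sum_reps_all !big_distrr /= big_mkcond /=.
  apply: leq_sum => g _; rewrite inE; case: ifP => //.
  by rewrite -ltnNge => /ltnW le; rewrite expnS expn1 mulnA leq_mul2r le orbT.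
move: energyS le1 le2 S_gt0; rewrite /energy (bigID [in P]) /= -/n.
move: (\sum_(g in P) reps S g ^ 2) (\sum_(g | g \notin P) reps S g ^ 2).
move: (\sum_(g in P) reps S g) => z x y.
move=> le3 le1 le2 n_gt0; rewrite -(leq_pmul2r n_gt0).
have {}le1 : K * x <= K * (n * z) by rewrite leq_mul2l le1 orbT.
by rewrite (expnSr n 2) in le2 le3; lia.
Qed.

(** A bad pair lies in fewer than n/(128 K^2) neighbourhoods, and there are n^2 pairs. *)
Let sum_bad_le :
  \sum_(c in S) (128 * K ^ 2 * \sum_(a in N c) \sum_(b in N c) bad a b) <= n ^ 3.
Proof.
rewrite (eq_bigr (fun c => \sum_(a in S) \sum_(b in S)
    128 * K ^ 2 * (bad a b * (conn a c && conn b c)))); last first.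
  move=> c _; rewrite big_distrr big_mkcond [RHS]big_mkcond /=.
  apply: eq_bigr => a _; rewrite inE; case: (a \in S) => //=.
  rewrite -big_distrr /=; case: (conn a c) => /=; last first.
    by rewrite big1 ?muln0 // => b _; rewrite muln0.
  congr (_ * _); rewrite big_mkcond [RHS]big_mkcond; apply: eq_bigr => b _ /=.
  by rewrite inE; case: (b \in S) => //=; case: (conn b c); rewrite ?muln1 ?muln0.
rewrite exchange_big /= (expnS n 2) (expnS n 1) -sum_nat_const; apply: leq_sum => a _.
rewrite exchange_big /= -sum_nat_const; apply: leq_sum => b _.
rewrite -!big_distrr /= -card_sum_ind -/(codeg a b).
by case bad_ab: (bad a b); rewrite ?mul0n ?muln0 // mul1n ltnW.
Qed.

(** Averaging over [c]: by [edges_ge] and Cauchy-Schwarz the right-hand sides sum to at least 2 n^3,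
    while the bad pairs and the terms n^2 contribute at most n^3 each. *)
Let good_vertex : exists2 c, c \in S &
  128 * K ^ 2 * (\sum_(a in N c) \sum_(b in N c) bad a b) + n ^ 2
     <= 8 * K ^ 2 * #|N c| ^ 2.
Proof.
apply/exists_inP; apply: contraT => /exists_inPn none.
have le1 : \sum_(c in S) (8 * K ^ 2 * #|N c| ^ 2).+1 <=
    \sum_(c in S) (128 * K ^ 2 * (\sum_(a in N c) \sum_(b in N c) bad a b) + n ^ 2).
  by apply: leq_sum => c /none; rewrite -ltnNge.
have le2 := sum_bad_le.
have le3 := sqr_sum_nat [in S] (fun c => #|N c|).
have le4 := edges_ge.
move: le1; rewrite big_split /= sum_nat_const.
under eq_bigr do rewrite -addn1.
rewrite big_split /= sum_nat_const -big_distrr /= => le1.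
move: le2 le3 le4 S_gt0 le1; rewrite -/n.
move: (\sum_(c in S) _ * _) => x; move: (\sum_(c in S) _ ^ 2) => y.
move: (\sum_(c in S) _) => z h2 h3 h4 n0 h1.
have : n ^ 4 <= 4 * K ^ 2 * (n * y) by nia.
nia.
Qed.

(** The constant is 2 * 512^2 * K^8, from the square of the bound for [Q], times 12 K^2, from n <= 3
    K |B| and n <= 4 K |A|. *)
Lemma bsg_nonempty : exists A, [/\ A \subset S, #|S| <= 4 * K * #|A| &
  #|(A^-1 * A)%g| <= 24 * 512 ^ 2 * K ^ 10 * #|A|].
Proof.
have [c cS] := good_vertex; set B := N c => cP.
(* With at most a quarter of [B] bad for each element, two elements of [A] have at least half of [B]
   good for both. *)
set A := [set a in B | 4 * \sum_(b in B) bad a b <= #|B|].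
have sAB : A \subset B by apply/subsetP=> a; rewrite inE => /andP[].
have sBS : B \subset S by apply/subsetP=> a; rewrite inE => /andP[].
have K_gt0 : 0 < K.
  by rewrite lt0n; apply/eqP => K0; move: energyS S_gt0; rewrite K0; case: #|S|.
have leB : n <= 3 * K * #|B|.
  rewrite -leq_sqr; apply: leq_trans (leq_addl _ _) (leq_trans cP _).
  by rewrite !expnMn; lia.
have B_gt0 : 0 < #|B|.
  by rewrite lt0n; apply/eqP => B0; move: leB S_gt0; rewrite B0 -/n; lia.
have fewbad : 16 * (\sum_(a in B) \sum_(b in B) bad a b) <= #|B| ^ 2.
  have := leq_trans (leq_addr _ _) cP.
  move: (\sum_(a in B) _) => x; rewrite (_ : 128 * K ^ 2 * x = 8 * K ^ 2 * (16 * x)); last lia.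
  by rewrite leq_pmul2l // muln_gt0 expn_gt0 K_gt0.
have leBA : 3 * #|B| <= 4 * #|A|.
  have : #|B :\: A| * #|B| <= 4 * (\sum_(a in B) \sum_(b in B) bad a b).
    rewrite (big_setID A) /= mulnDr; apply: leq_trans (leq_addl _ _).
    rewrite big_distrr -sum_nat_const; apply: leq_sum => a /=.
    by rewrite !inE => /andP[+ aB]; rewrite aB /= -ltnNge => /ltnW.
  have := cardsID A B; rewrite (setIidPr sAB); move: B_gt0.
  nia.
exists A; split; first exact: subset_trans sAB sBS.
  by rewrite -/n; nia.
(* Products of two popular quotients in at least n/(128 K^2) ways. Each common neighbour of a good
   pair gives one such factorization of its quotient. *)
pose Q := [set g | n <= 128 * K ^ 2 * #|[set u in P | (u^-1 * g)%g \in P]|].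
have goodQ a b : a \in B -> b \in B -> ~~ bad a b -> (a^-1 * b)%g \in Q.
  move=> aB bB; rewrite -leqNgt inE => /leq_trans; apply.
  rewrite leq_mul2l; apply/orP; right.
  rewrite /codeg -(card_lcoset [set c in S | conn a c && conn b c] a^-1); apply: subset_leq_card.
  apply/subsetP=> u; rewrite mem_lcoset invgK inE => /and3P[_].
  by rewrite (conn_sym b) /conn mulKg invMg -mulgA => uP vP; rewrite inE uP.
have cardQ : #|Q| <= 512 * K ^ 4 * n.
  have : #|Q| * n <= 128 * K ^ 2 * (#|P| * #|P|).
    by apply: card_mul_reps => g; rewrite inE.
  have := leq_mul cardP_le cardP_le; move: S_gt0; rewrite -/n.
  move: (#|P| * #|P|) #|Q| => x y n_gt0 le1 le2.
  rewrite -(leq_pmul2r n_gt0); apply: leq_trans le2 _.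
  apply: leq_trans (leq_mul (leqnn _) le1) _.
  by rewrite -[4]/(2 + 2) expnD; lia.
have : #|(A^-1 * A)%g| * #|B| <= 2 * (#|Q| * #|Q|).
  (* Each [e] good for both [a] and [b] gives [a^-1 * b = (a^-1 * e) * (e^-1 * b)] with both factors
     in [Q]. *)
  apply: card_mul_reps => _ /mulsgP[x b + bA ->]; rewrite mem_invg.
  move: (x^-1)%g (invgK x) => a <- aA {x}.
  set G := [set e in B | ~~ bad a e && ~~ bad b e].
  have leG : #|B| <= 2 * #|G|.
    have : #|B :\: G| <= \sum_(e in B) bad a e + \sum_(e in B) bad b e.
      rewrite -big_split /= -sum1_card big_mkcond [leqRHS]big_mkcond /=.
      apply: leq_sum => e _; rewrite !inE; case: (_ && conn e c) => //=.
      by case: (bad a e); case: (bad b e).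
    have := cardsID G B; rewrite (setIidPr _); last first.
      by apply/subsetP=> e; rewrite inE => /andP[].
    move: aA bA; rewrite !inE => /andP[_ +] /andP[_ +]; lia.
  apply: leq_trans leG _; rewrite leq_mul2l /=.
  rewrite -(card_lcoset G a^-1); apply: subset_leq_card.
  apply/subsetP=> u; rewrite mem_lcoset invgK => /setIdP[auB /andP[ga gb]].
  apply/setIdP; split; first by rewrite -(mulKg a u) goodQ ?(subsetP sAB _ aA).
  rewrite (_ : u^-1 * (a^-1 * b) = (a * u)^-1 * b)%g ?goodQ ?(subsetP sAB _ bA) //.
    by rewrite bad_sym.
  by rewrite invMg mulgA.
have := leq_mul cardQ cardQ; move: leB leBA B_gt0; rewrite -/n.
move: (#|Q| * #|Q|) #|(A^-1 * A)%g| #|B| #|A| => x y b a le1 le2 b_gt0 le3 le4.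
rewrite -(leq_pmul2r b_gt0).
apply: leq_trans le4 _; move: 512 le3 => e le3.
apply: (@leq_trans (2 * (e * K ^ 4 * n * (e * K ^ 4 * n)))); first lia.
have le5 : n * n <= 3 * K * b * (4 * K * a).
  by apply: leq_mul => //; apply: leq_trans le1 _; nia.
apply: (@leq_trans (2 * (e * e * K ^ 8 * (3 * K * b * (4 * K * a))))).
  rewrite -[8]/(4 + 4) expnD.
  apply: (@leq_trans (2 * (e * e * (K ^ 4 * K ^ 4) * (n * n)))); first lia.
  by rewrite !leq_mul2l le5 !orbT.
by rewrite -[10]/(8 + 2) expnD; move: (K ^ 8) => k8; lia.
Qed.
End BSG.
End Energy.

(** * Popular quotients: from small [A^-1 * A] to small powers *)

Section Popular.
Local Open Scope group_scope.
Local Open Scope nat_scope.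
Variable gT : finGroupType.
Implicit Types (A D P S U V Z : {set gT}) (g : gT).

(** The quotients [(d * b) * b^-1] are on the other side than in [reps]: this lets a factor [d] be
    absorbed next to [A] in a product. *)
Definition popular A K := [set d | #|A| <= 2 * K * #|[set b in A | (d * b)%g \in A]|].

Lemma popular1 A K : 0 < K -> 1%g \in popular A K.
Proof.
move=> K_gt0; rewrite inE (_ : [set b in A | _] = A) ?leq_pmull ?muln_gt0 //.
by apply/setP=> b; rewrite inE mul1g andbb.
Qed.

Lemma popularV A K : (popular A K)^-1%g = popular A K.
Proof.
apply/setP=> d; rewrite mem_invg !inE; congr (_ <= _ * _).
rewrite -[RHS](card_lcoset _ d); apply: eq_card => b.
by rewrite mem_lcoset !inE mulKVg andbC.
Qed.

Lemma popular_sub A K : A != set0 -> popular A K \subset (A * A^-1)%g.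
Proof.
rewrite -card_gt0 => A_gt0; apply/subsetP=> d; rewrite inE => le.
have : 0 < #|[set b in A | (d * b)%g \in A]|.
  by rewrite lt0n; apply: contraTneq le => ->; rewrite muln0 -ltnNge.
case/card_gt0P=> b; rewrite inE => /andP[bA dbA].
by rewrite -(mulgK b d) mem_mulg // mem_invg invgK.
Qed.

(** Each [e] in [A] with [d * e] in [A] splits [u * d * b] into [u * (d * e)] and [e^-1 * b]. *)
Lemma card_mul_popular A K U :
  #|(U * popular A K * A)%g| * #|A| <= 2 * K * (#|(U * A)%g| * #|(A^-1 * A)%g|).
Proof.
apply: card_mul_reps => _ /mulsgP[_ b /mulsgP[u d uU dD ->] bA ->].
move: dD; rewrite inE => /leq_trans; apply; rewrite leq_mul2l; apply/orP; right.
rewrite -(card_lcoset _ (u * d)%g); apply/subset_leq_card/subsetP=> z.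
rewrite mem_lcoset => /setIdP[eA deA].
have zE : z = (u * (d * ((u * d)^-1 * z)))%g by rewrite mulgA mulKVg.
apply/setIdP; split; first by rewrite zE mem_mulg.
rewrite (_ : z^-1 * (u * d * b) = ((u * d)^-1 * z)^-1 * b)%g; last by rewrite invMg invgK mulgA.
by rewrite mem_mulg // mem_invg invgK.
Qed.

(** The induction bounds [D ^+ m * A] rather than [D ^+ m]: with [A] kept on the right, each further
    factor [D] costs 2 K^2. *)
Lemma card_popularX A K m : A != set0 ->
  #|(A^-1 * A)%g| <= K * #|A| -> #|(popular A K ^+ m)%g| <= (2 * K ^ 2) ^ m * #|A|.
Proof.
set D := popular A K => A_neq0 leK; have A_gt0 : 0 < #|A| by rewrite card_gt0.
have [a aA] := set0Pn _ A_neq0.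
apply: (@leq_trans #|(D ^+ m * A)%g|).
  rewrite -(card_rcoset _ a); apply: subset_leq_card.
  by rewrite mulgS // sub1set.
elim: m => [|m IHm]; first by rewrite expg0 mul1g mul1n.
rewrite -(leq_pmul2r A_gt0) expgSr.
apply: leq_trans (card_mul_popular _ _ _) _.
apply: leq_trans (leq_mul (leqnn _) (leq_mul IHm leK)) _.
by rewrite (expnS (2 * K ^ 2)); move: (_ ^ m) => x; lia.
Qed.

Lemma energy_pairs A :
  energy A = \sum_(a in A) \sum_(c in A) #|[set b in A | (c * a^-1 * b)%g \in A]|.
Proof.
rewrite /energy (eq_bigr (fun g =>
  \sum_(a in A) \sum_(c in A) (((a * g)%g \in A) && ((c * g)%g \in A)))).
  rewrite exchange_big; apply: eq_bigr => a _ /=.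
  rewrite exchange_big; apply: eq_bigr => c _ /=.
  rewrite card_sum_ind (reindex_inj (mulgI a^-1%g)) /= [RHS]big_mkcond /=.
  by apply: eq_bigr => b _; rewrite mulKVg mulgA; case: (b \in A).
move=> g _; rewrite /reps expnS expn1 card_sum_ind big_distrlr /=.
by apply: eq_bigr => a _; apply: eq_bigr => c _; rewrite mulnb.
Qed.

(** Small [A^-1 * A] forces large energy by Cauchy-Schwarz. Read through [energy_pairs], large
    energy means many pairs [(a, c)] with [c * a^-1] popular, hence one [a] with many such [c]. *)
Lemma popular_coset A K : A != set0 -> #|(A^-1 * A)%g| <= K * #|A| ->
  exists2 a, a \in A & #|A| <= 2 * K * #|A :&: (popular A K :* a)%g|.
Proof.
set D := popular A K; rewrite -card_gt0 => A_gt0 leK.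
have leE : #|A| ^ 3 <= K * energy A.
  have := sqr_sum_nat [in (A^-1 * A)%g] (reps A).
  rewrite (_ : \sum_(g in _) reps A g = #|A| ^ 2); last first.
    rewrite -sum_reps_all [RHS](bigID [in (A^-1 * A)%g]) /= [X in _ + X]big1 ?addn0 //.
    move=> g notg; apply/eqP; rewrite cards_eq0; apply/eqP/setP=> a; rewrite !inE.
    apply: contraNF notg => /andP[aA agA].
    by rewrite -(mulKg a g) mem_mulg // mem_invg invgK.
  have : \sum_(g in (A^-1 * A)%g) reps A g ^ 2 <= energy A.
    by rewrite /energy big_mkcond leq_sum // => g _; case: ifP.
  move: (\sum_(g in _) _) => x lex.
  move=> le; rewrite -(leq_pmul2r A_gt0) -expnSr (expnM _ 2 2); apply: leq_trans le _.
  rewrite mulnAC; exact: leq_mul.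
apply/exists_inP; apply: contraT => /exists_inPn none.
have : \sum_(a in A) \sum_(c in A) 2 * K * #|[set b in A | (c * a^-1 * b)%g \in A]| <=
   \sum_(a in A) (#|A| * (2 * K * #|A :&: (D :* a)%g|) + #|A| * #|A|).
  apply: leq_sum => a aA.
  apply: (@leq_trans (\sum_(c in A) ((c \in D :* a)%g * (2 * K * #|A|) + #|A|))).
    apply: leq_sum => c cA; rewrite mem_rcoset inE.
    case: (leqP #|A| _) => [_|/ltnW le]; last by rewrite mul0n.
    rewrite mul1n; apply: leq_trans (leq_addr _ _); rewrite leq_mul2l; apply/orP; right.
    by apply/subset_leq_card/subsetP=> b; rewrite inE => /andP[].
  rewrite big_split /= sum_nat_const leq_add2r -big_distrl /= mulnC -mulnA mulnCA.
  rewrite !leq_mul2l; apply/orP; right; apply/orP; right.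
  rewrite -card_sum_ind; apply: subset_leq_card; apply/subsetP=> c.
  by rewrite !inE.
rewrite (_ : \sum_(a in A) _ = 2 * K * energy A); last first.
  rewrite energy_pairs big_distrr; apply: eq_bigr => a _.
  by rewrite big_distrr.
have : \sum_(a in A) (2 * K * #|A :&: (D :* a)%g|).+1 <= \sum_(a in A) #|A|.
  by apply: leq_sum => a /none; rewrite -ltnNge.
under eq_bigr do rewrite -addn1.
rewrite !big_split /= !sum_nat_const -!big_distrr /=.
move: (\sum_(a in A) _) (energy A) leE A_gt0 => x E leE A_gt0.
rewrite !(expnS, expn0) in leE; move: #|A| leE A_gt0 => n leE n_gt0.
move=> le1; have := leq_mul (leqnn n) le1; rewrite !muln1 mulnDr in leE *.
move: (n * (2 * K * x)) (n * (n * n)) (muln_gt0 n n) leE => u v + leE.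
by rewrite n_gt0 -mulnA; lia.
Qed.
End Popular.

(** * Two by two matrices *)

Section Matrix2.
Variable F : fieldType.
Implicit Types (M N W X Y : 'M[F]_2) (u v w : 'cV[F]_2) (a b c s : F).

Lemma sum2E (V : zmodType) (f : 'I_2 -> V) : \sum_i f i = f 0 + f 1.
Proof. by rewrite big_ord_recl big_ord1; congr (_ + f _); apply: val_inj. Qed.

Lemma mulmx2E m n (A : 'M[F]_(m, 2)) (B : 'M[F]_(2, n)) i j :
  (A *m B) i j = A i 0 * B 0 j + A i 1 * B 1 j.
Proof. by rewrite mxE sum2E. Qed.

Lemma det2E M : \det M = M 0 0 * M 1 1 - M 0 1 * M 1 0.
Proof.
rewrite (expand_det_row _ 0) sum2E /cofactor !det_mx11 !mxE /=.
rewrite (_ : lift 0 0 = 1); last exact: val_inj.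
rewrite (_ : lift 1 0 = 0); last exact: val_inj.
by rewrite /= expr0 expr1 mul1r mulN1r mulrN.
Qed.

Lemma trace2E M : \tr M = M 0 0 + M 1 1.
Proof. by rewrite /mxtrace sum2E. Qed.

Lemma ord2P (i : 'I_2) : i = 0 \/ i = 1.
Proof. by case: i => [[|[|//]]] i_lt; [left|right]; apply: val_inj. Qed.

Lemma matrix2P M N :
  [/\ M 0 0 = N 0 0, M 0 1 = N 0 1, M 1 0 = N 1 0 & M 1 1 = N 1 1] -> M = N.
Proof.
case=> e00 e01 e10 e11; apply/matrixP=> i j.
by case: (ord2P i) => ->; case: (ord2P j) => ->.
Qed.

Lemma colvec2P u v : u 0 0 = v 0 0 -> u 1 0 = v 1 0 -> u = v.
Proof.
move=> e0 e1; apply/matrixP=> i j; rewrite (ord1 j).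
by case: (ord2P i) => ->.
Qed.

Lemma colvec2_neq0 v : v != 0 -> v 0 0 != 0 \/ v 1 0 != 0.
Proof.
move=> v_neq0; have [v0|] := eqVneq (v 0 0) 0; last by left.
right; apply: contra_neq v_neq0 => v1.
by apply: colvec2P; rewrite !mxE.
Qed.

(* These reduce an equation that is a linear combination of hypotheses, with
   given coefficients, to a ring identity. *)
Lemma eq_lin1 (k l r x y : F) : l = r -> x - y = k * (l - r) -> x = y.
Proof. by move=> -> /eqP; rewrite subrr mulr0 subr_eq0 => /eqP. Qed.

Lemma eq_lin2 (k1 k2 l1 l2 r1 r2 x y : F) : l1 = r1 -> l2 = r2 ->
  x - y = k1 * (l1 - r1) + k2 * (l2 - r2) -> x = y.
Proof. by move=> -> ->; rewrite !subrr !mulr0 addr0 => /eqP; rewrite subr_eq0 => /eqP. Qed.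

Lemma eq_lin3 (k1 k2 k3 l1 l2 l3 r1 r2 r3 x y : F) : l1 = r1 -> l2 = r2 -> l3 = r3 ->
  x - y = k1 * (l1 - r1) + k2 * (l2 - r2) + k3 * (l3 - r3) -> x = y.
Proof.
move=> -> -> ->; rewrite !subrr !mulr0 !addr0 => /eqP.
by rewrite subr_eq0 => /eqP.
Qed.

Lemma eq_lin4 (k1 k2 k3 k4 l1 l2 l3 l4 r1 r2 r3 r4 x y : F) :
  l1 = r1 -> l2 = r2 -> l3 = r3 -> l4 = r4 ->
  x - y = k1 * (l1 - r1) + k2 * (l2 - r2) + k3 * (l3 - r3) + k4 * (l4 - r4) -> x = y.
Proof.
move=> -> -> -> ->; rewrite !subrr !mulr0 !addr0 => /eqP.
by rewrite subr_eq0 => /eqP.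
Qed.

(** The symplectic form of the plane: it detects collinearity and is preserved by SL_2. *)
Definition cross v w := v 0 0 * w 1 0 - v 1 0 * w 0 0.

Lemma cross_eq0 v w : v != 0 -> cross v w = 0 -> exists c, w = c *: v.
Proof.
rewrite /cross => /colvec2_neq0[v_neq0|v_neq0] e.
  exists (w 0 0 / v 0 0); apply: colvec2P; rewrite !mxE; first by field.
  by apply: (eq_lin1 (k := (v 0 0)^-1) e); field.
exists (w 1 0 / v 1 0); apply: colvec2P; rewrite !mxE; last by field.
by apply: (eq_lin1 (k := - (v 1 0)^-1) e); field.
Qed.

Lemma crossZ v c : cross v (c *: v) = 0.
Proof. by rewrite /cross !mxE; ring. Qed.

Lemma cross_mul M v w : cross (M *m v) (M *m w) = \det M * cross v w.
Proof. by rewrite /cross !mulmx2E det2E; ring. Qed.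

Lemma mul_cross_inj M N v w : cross v w != 0 ->
  M *m v = N *m v -> M *m w = N *m w -> M = N.
Proof.
move=> vw_neq0 /matrixP ev /matrixP ew; move: vw_neq0; rewrite /cross.
have := ev 0 0; have := ev 1 0; have := ew 0 0; have := ew 1 0.
rewrite !mulmx2E; move: (v 0 0) (v 1 0) (w 0 0) (w 1 0) => x y z t e1 e2 e3 e4 nz.
apply: matrix2P; split; apply: (mulfI nz).
- by apply: (eq_lin2 (k1 := t) (k2 := - y) e4 e2); ring.
- by apply: (eq_lin2 (k1 := - z) (k2 := x) e4 e2); ring.
- by apply: (eq_lin2 (k1 := t) (k2 := - y) e3 e1); ring.
- by apply: (eq_lin2 (k1 := - z) (k2 := x) e3 e1); ring.
Qed.

Definition eigen M v := exists c, M *m v = c *: v.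

(** [N] is nilpotent of rank one, a column [v] times a row whose kernel is the line of [v]. Then
    [\tr (M *m N)] is that row applied to [M *m v], and it vanishes only if [M *m v] is on the
    line. *)
Lemma nilpotent_line N : N != 0 -> \tr N = 0 -> \det N = 0 ->
  exists2 v, v != 0 & forall M, \tr (M *m N) = 0 -> eigen M v.
Proof.
rewrite trace2E det2E => N_neq0 trN detN.
have [i colN] : exists i, col i N != 0.
  have [c0|] := eqVneq (col 0 N) 0; last by exists 0.
  exists 1; apply: contra_neq N_neq0 => c1.
  move/matrixP: c0 => c0; move/matrixP: c1 => c1.
  by apply: matrix2P; split; have := c0 0 0; have := c0 1 0; have := c1 0 0;
    have := c1 1 0; rewrite !mxE.
exists (col i N) => // M; rewrite trace2E !mulmx2E => trMN.
apply: cross_eq0 => //; rewrite /cross !mulmx2E !mxE.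
case: (ord2P i) => -> {i colN}.
  by apply: (eq_lin3 (k1 := - N 1 0) (k2 := M 1 1 * N 1 0 + M 1 0 * N 0 0)
    (k3 := - M 1 0) trMN trN detN); ring.
by apply: (eq_lin3 (k1 := N 0 1) (k2 := - (M 0 0 * N 0 1 + M 0 1 * N 1 1))
  (k3 := M 0 1) trMN trN detN); ring.
Qed.

Lemma commute_span X Y : ~~ is_scalar_mx Y -> X *m Y = Y *m X ->
  exists a b, X = a%:M + b *: Y.
Proof.
move=> Y_nsc /matrixP comm.
have := comm 0 0; have := comm 0 1; have := comm 1 0; rewrite !mulmx2E => e10 e01 e00.
have [y01|y01] := eqVneq (Y 0 1) 0; last first.
  exists (X 0 0 - X 0 1 / Y 0 1 * Y 0 0), (X 0 1 / Y 0 1).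
  apply: matrix2P; rewrite !mxE /= ?mulr1n ?mulr0n; split; try by field.
    by apply: (eq_lin1 (k := - (Y 0 1)^-1) e00); field.
  by apply: (eq_lin1 (k := - (Y 0 1)^-1) e01); field.
have [y10|y10] := eqVneq (Y 1 0) 0; last first.
  exists (X 0 0 - X 1 0 / Y 1 0 * Y 0 0), (X 1 0 / Y 1 0).
  apply: matrix2P; rewrite !mxE /= ?mulr1n ?mulr0n; split; try by field.
    by apply: (eq_lin1 (k := (Y 1 0)^-1) e00); field.
  by apply: (eq_lin1 (k := (Y 1 0)^-1) e10); field.
have y_neq : Y 0 0 - Y 1 1 != 0.
  apply: contraNneq Y_nsc => /eqP; rewrite subr_eq0 => /eqP y.
  apply/is_scalar_mxP; exists (Y 0 0); apply: matrix2P.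
  by rewrite !mxE /= ?mulr1n ?mulr0n.
rewrite y01 y10 in e10 e01 *.
exists (X 0 0 - (X 0 0 - X 1 1) / (Y 0 0 - Y 1 1) * Y 0 0),
  ((X 0 0 - X 1 1) / (Y 0 0 - Y 1 1)).
apply: matrix2P; rewrite !mxE /= ?mulr1n ?mulr0n y01 y10; split; try by field.
  by apply: (mulfI y_neq); apply: (eq_lin1 (k := - 1) e01); field.
by apply: (mulfI y_neq); apply: (eq_lin1 (k := 1) e10); field.
Qed.

(** The determinant is a quadratic form on 2 by 2 matrices, and [\tr (\adj W *m M)] is its polar
    form. *)
Lemma det_pencil W M s :
  \det (W + s *: M) = \det W + s * \tr (\adj W *m M) + s ^+ 2 * \det M.
Proof.
rewrite trace2E !mulmx2E /adjugate !mxE /cofactor !det_mx11 !mxE /=.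
rewrite (_ : lift 0 0 = 1); last exact: val_inj.
rewrite (_ : lift 1 0 = 0); last exact: val_inj.
rewrite -[(1 %% 2)%N]/1%N !addn0 !add0n -[(1 + 1)%N]/2%N sqrrN expr1 expr0 expr1n.
by rewrite !det2E !mxE; ring.
Qed.
End Matrix2.

Section Perp.
Variable F : fieldType.
Implicit Types (M N Z : 'M[F]_2).

(* For trace-zero [M], [\tr (M *m Z)] is the dot product of
   [(M 0 0, M 0 1, M 1 0)] with [(Z 0 0 - Z 1 1, Z 1 0, Z 0 1)]; the last two
   vectors are both multiples of a cross product when [M] and [N] are independent. *)
Lemma traceless_perp M N Z1 Z2 : M != 0 -> \tr M = 0 -> \tr N = 0 ->
  \tr (M *m Z1) = 0 -> \tr (M *m Z2) = 0 ->
  \tr (N *m Z1) = 0 -> \tr (N *m Z2) = 0 ->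
  (exists s, N = s *: M) \/
  exists a b c, (b != 0) || (c != 0) /\ b *: Z1 + c *: Z2 = a%:M.
Proof.
rewrite !trace2E !mulmx2E => M_neq0 trM trN.
have eM : M 1 1 = - M 0 0 by apply: (eq_lin1 (k := 1) trM); ring.
have eN : N 1 1 = - N 0 0 by apply: (eq_lin1 (k := 1) trN); ring.
rewrite eM eN => e1 e2 e3 e4.
pose c0 := M 0 1 * N 1 0 - M 1 0 * N 0 1.
pose c1 := M 1 0 * N 0 0 - M 0 0 * N 1 0.
pose c2 := M 0 0 * N 0 1 - M 0 1 * N 0 0.
have [/and3P[/eqP z0 /eqP z1 /eqP z2]|nz] := boolP [&& c0 == 0, c1 == 0 & c2 == 0].
  left; rewrite /c0 /c1 /c2 in z0 z1 z2.
  have [m0|m0] := eqVneq (M 0 0) 0; last first.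
    exists (N 0 0 / M 0 0); apply: matrix2P; rewrite !mxE eM eN; split; try by field.
      by apply: (eq_lin1 (k := (M 0 0)^-1) z2); field.
    by apply: (eq_lin1 (k := - (M 0 0)^-1) z1); field.
  have [m1|m1] := eqVneq (M 0 1) 0; last first.
    exists (N 0 1 / M 0 1); apply: matrix2P; rewrite !mxE eM eN; split; try by field.
    - by apply: (eq_lin1 (k := - (M 0 1)^-1) z2); field.
    - by apply: (eq_lin1 (k := (M 0 1)^-1) z0); field.
    by apply: (eq_lin1 (k := (M 0 1)^-1) z2); field.
  have [m2|m2] := eqVneq (M 1 0) 0; last first.
    exists (N 1 0 / M 1 0); apply: matrix2P; rewrite !mxE eM eN; split; try by field.
    - by apply: (eq_lin1 (k := (M 1 0)^-1) z1); field.
    - by apply: (eq_lin1 (k := - (M 1 0)^-1) z0); field.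
    by apply: (eq_lin1 (k := - (M 1 0)^-1) z1); field.
  case/eqP: M_neq0; apply: matrix2P; by rewrite !mxE eM m0 m1 m2 oppr0.
right.
have span Z : M 0 0 * Z 0 0 + M 0 1 * Z 1 0 + (M 1 0 * Z 0 1 + - M 0 0 * Z 1 1) = 0 ->
    N 0 0 * Z 0 0 + N 0 1 * Z 1 0 + (N 1 0 * Z 0 1 + - N 0 0 * Z 1 1) = 0 ->
  exists s, [/\ Z 0 0 - Z 1 1 = s * c0, Z 1 0 = s * c1 & Z 0 1 = s * c2].
  move=> p q; move: nz; rewrite !negb_and => /or3P[] nz.
  - exists ((Z 0 0 - Z 1 1) / c0); split; first by field.
      apply: (mulfI nz); apply: (eq_lin2 (k1 := N 1 0) (k2 := - M 1 0) p q).
      by rewrite /c0 /c1 /c2 in nz *; field.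
    apply: (mulfI nz); apply: (eq_lin2 (k1 := - N 0 1) (k2 := M 0 1) p q).
    by rewrite /c0 /c1 /c2 in nz *; field.
  - exists (Z 1 0 / c1); split; try by field.
      apply: (mulfI nz); apply: (eq_lin2 (k1 := - N 1 0) (k2 := M 1 0) p q).
      by rewrite /c0 /c1 /c2 in nz *; field.
    apply: (mulfI nz); apply: (eq_lin2 (k1 := N 0 0) (k2 := - M 0 0) p q).
    by rewrite /c0 /c1 /c2 in nz *; field.
  exists (Z 0 1 / c2); split; try by field.
    apply: (mulfI nz); apply: (eq_lin2 (k1 := N 0 1) (k2 := - M 0 1) p q).
    by rewrite /c0 /c1 /c2 in nz *; field.
  apply: (mulfI nz); apply: (eq_lin2 (k1 := - N 0 0) (k2 := M 0 0) p q).
  by rewrite /c0 /c1 /c2 in nz *; field.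
have [s [s0 s1 s2]] := span _ e1 e3; have [t [t0 t1 t2]] := span _ e2 e4.
have comb b c : b * s + c * t = 0 ->
    b *: Z1 + c *: Z2 = (b * Z1 0 0 + c * Z2 0 0)%:M.
  move=> e; apply: matrix2P; rewrite !mxE /= ?mulr1n ?mulr0n; split => //.
  - by rewrite s2 t2; apply: (eq_lin1 (k := c2) e); ring.
  - by rewrite s1 t1; apply: (eq_lin1 (k := c1) e); ring.
  by apply: (eq_lin3 (k1 := - b) (k2 := - c) (k3 := - c0) s0 t0 e); ring.
have [s_eq0|s_neq0] := eqVneq s 0.
  exists (1 * Z1 0 0 + 0 * Z2 0 0), 1, 0; split; first by rewrite oner_eq0.
  by apply: comb; rewrite s_eq0; ring.
exists (- t * Z1 0 0 + s * Z2 0 0), (- t), s; split; first by rewrite s_neq0 orbT.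
by apply: comb; ring.
Qed.
End Perp.

(** * Conjugacy classes of SL_2 in sets of small tripling *)

Section SL.
Variable F : finFieldType.
Implicit Types (x y z g : {'GL_2[F]}) (v w : 'cV[F]_2).

Definition SL : {set {'GL_2[F]}} := [set g | \det (GLval g) == 1].

Definition trG g : F := \tr (GLval g).

Lemma SL_group_set : group_set SL.
Proof.
apply/group_setP; split=> [|g h]; first by rewrite inE GL_1E det1.
by rewrite !inE GL_MxE det_mulmx => /eqP-> /eqP->; rewrite mulr1.
Qed.

Canonical SL_group := Group SL_group_set.

Lemma GLval_inj : injective (@GLval 2 F).
Proof. exact: val_inj. Qed.

Lemma GLmulVx g : GLval g^-1%g *m GLval g = 1%:M.
Proof. by rewrite -GL_MxE mulVg GL_1E. Qed.

Lemma GLmulxV g : GLval g *m GLval g^-1%g = 1%:M.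
Proof. by rewrite -GL_MxE mulgV GL_1E. Qed.

Lemma SL_det x : x \in SL -> \det (GLval x) = 1.
Proof. by rewrite inE => /eqP. Qed.

Lemma SL_V x : x \in SL -> x^-1%g \in SL.
Proof. by move=> /SL_det dx; rewrite inE GL_VxE det_inv dx invr1. Qed.

Lemma SL_M x y : x \in SL -> y \in SL -> (x * y)%g \in SL.
Proof.
by move=> /SL_det dx /SL_det dy; rewrite inE (GL_MxE x y) det_mulmx dx dy mulr1.
Qed.

Lemma SL_J x y : x \in SL -> y \in SL -> (x ^ y)%g \in SL.
Proof. by move=> xSL ySL; apply: SL_M (SL_V ySL) (SL_M xSL ySL). Qed.

Lemma SL_inv x : x \in SL -> GLval x^-1%g = (trG x)%:M - GLval x.
Proof.
move=> /SL_det dx; rewrite -[RHS]mulmx1 -(GLmulxV x) mulmxA.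
rewrite (_ : _ *m GLval x = 1%:M) ?mul1mx //.
move: dx; rewrite det2E /trG trace2E => dx.
apply: matrix2P; rewrite !mulmx2E !mxE /= ?mulr1n ?mulr0n.
by split; try ring; apply: (eq_lin1 (k := 1) dx); ring.
Qed.

Lemma SL_adj x : x \in SL -> \adj (GLval x^-1%g) = GLval x.
Proof.
move=> xSL; have := mul_mx_adj (GLval x^-1%g).
rewrite (SL_det (SL_V xSL)) => e.
by rewrite -[LHS]mul1mx -(GLmulxV x) -mulmxA e mulmx1.
Qed.

Lemma trG_conj x g : trG (x ^ g) = trG x.
Proof. by rewrite /trG conjgE GL_MxE mxtrace_mulC -GL_MxE mulgK. Qed.

Lemma trG_inv x : x \in SL -> trG x^-1%g = trG x.
Proof.
move=> xSL; rewrite /trG SL_inv // /trG !trace2E !mxE /= !mulr1n.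
by ring.
Qed.

Definition eigenG x v := [exists c, GLval x *m v == c *: v].

Lemma eigenGP x v : reflect (eigen (GLval x) v) (eigenG x v).
Proof. by apply: (iffP existsP) => -[c /eqP]; exists c => //; apply/eqP. Qed.

Lemma GLmul_eq0 x v : (GLval x *m v == 0) = (v == 0).
Proof.
apply/eqP/eqP=> [e|->]; last by rewrite mulmx0.
by rewrite -[v]mul1mx -(GLmulVx x) -mulmxA e mulmx0.
Qed.

Lemma eigenGMl x y v : eigenG x v -> eigenG (x * y) v -> eigenG y v.
Proof.
move=> /existsP[a /eqP ea] /existsP[b /eqP].
have [->|v_neq0] := eqVneq v 0; first by move=> _; apply/existsP; exists 0; rewrite mulmx0 scaler0.
have a_neq0 : a != 0.
  apply: contra_neq v_neq0 => a0; apply/eqP.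
  by rewrite -(GLmul_eq0 x) ea a0 scale0r.
rewrite GL_MxE -mulmxA => eb; apply/existsP; exists (b / a); apply/eqP.
rewrite -[LHS]mul1mx -(GLmulVx x) -mulmxA eb -scalemxAr.
by rewrite -[in LHS](scalerK a_neq0 v) -ea -scalemxAr mulmxA GLmulVx mul1mx scalerA.
Qed.

Lemma eigenG_group_set v : group_set [set g | eigenG g v].
Proof.
apply/group_setP; split=> [|g h]; rewrite !inE.
  by apply/existsP; exists 1; rewrite mul1mx scale1r.
move=> /existsP[a /eqP ea] /existsP[b /eqP eb]; apply/existsP; exists (b * a).
by rewrite GL_MxE -mulmxA eb -scalemxAr ea scalerA.
Qed.

Definition share_line x y := [exists v, [&& v != 0, eigenG x v & eigenG y v]].

Definition share_line3 x y z :=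
  [exists v, [&& v != 0, eigenG x v, eigenG y v & eigenG z v]].

Lemma nilpotent_share x y z N : N != 0 -> \tr N = 0 -> \det N = 0 ->
  \tr (GLval x *m N) = 0 -> \tr (GLval (x * y)%g *m N) = 0 ->
  \tr (GLval (x * z)%g *m N) = 0 -> share_line3 x y z.
Proof.
move=> N_neq0 trN detN tx txy txz.
have [v v_neq0 vP] := nilpotent_line N_neq0 trN detN.
have /eigenGP ex := vP _ tx; have /eigenGP exy := vP _ txy; have /eigenGP exz := vP _ txz.
apply/existsP; exists v; rewrite v_neq0 ex (eigenGMl ex exy) (eigenGMl ex exz).
by [].
Qed.

(** Along the line through [x^-1] in direction [M] the determinant is a polynomial of degree at most
    2 taking the value 1 at the parameters 0, 1 and [s]; so it is constant. *)
Lemma pencil_isotropic x M s : x \in SL -> s != 0 -> s != 1 ->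
  \det (GLval x^-1%g + M) = 1 -> \det (GLval x^-1%g + s *: M) = 1 ->
  \det M = 0 /\ \tr (GLval x *m M) = 0.
Proof.
move=> xSL s0 s1; rewrite -{1}(scale1r M) !det_pencil (SL_adj xSL) (SL_det (SL_V xSL)).
rewrite expr1n !mul1r => e1 e2.
have nz : s * (s - 1) != 0 by rewrite mulf_neq0 // subr_eq0.
split; apply: (mulfI nz).
  by apply: (eq_lin2 (k1 := - s) (k2 := 1) e1 e2); ring.
by apply: (eq_lin2 (k1 := s ^+ 2) (k2 := - 1) e1 e2); ring.
Qed.

(* If [b *: X2 + c *: X3 + a *: X^-1 = 0] then, traces being equal, [X3] lies
   on the affine line through [X^-1] and [X2], which has three points of [SL]. *)
Lemma dependent_share x x2 x3 (a b c : F) : x \in SL -> x2 \in SL -> x3 \in SL ->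
  trG x != 0 -> trG x2 = trG x -> trG x3 = trG x ->
  x2 != x^-1%g -> x3 != x^-1%g -> x2 != x3 ->
  (b != 0) || (c != 0) ->
  b *: GLval (x * x2)%g + c *: GLval (x * x3)%g = a%:M -> share_line3 x x2 x3.
Proof.
move=> xSL x2SL x3SL t_neq0 t2 t3 n2 n3 n23 bc e.
set W := GLval x^-1%g.
have {}e : b *: GLval x2 + c *: GLval x3 = a *: W.
  rewrite -[LHS]mul1mx -(GLmulVx x) -mulmxA mulmxDr -!scalemxAr -!GL_MxE e.
  by rewrite mul_mx_scalar.
have eabc : a = b + c.
  move: (congr1 mxtrace e); rewrite mxtraceD !mxtraceZ -!/(trG _) trG_inv // t2 t3.
  by rewrite -mulrDl => /(mulIf t_neq0).
have c_neq0 : c != 0.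
  apply/eqP=> c0; move: bc e n2; rewrite eabc c0 eqxx orbF scale0r !addr0 => b0.
  by move/(scalerI b0)/GLval_inj => ->; rewrite eqxx.
have b_neq0 : b != 0.
  apply/eqP=> b0; move: e n3; rewrite eabc b0 scale0r !add0r.
  by move/(scalerI c_neq0)/GLval_inj => ->; rewrite eqxx.
pose M := GLval x2 - W; pose s := - (b / c).
have eX2 : GLval x2 = W + M by rewrite addrC subrK.
have eX3 : GLval x3 = W + s *: M.
  apply: (scalerI c_neq0); move: e; rewrite eabc.
  move/(canRL (addKr _)) => ->; rewrite /M /s.
  by apply: matrix2P; split; rewrite !mxE; field.
have s_neq0 : s != 0 by rewrite oppr_eq0 mulf_neq0 ?invr_eq0.
have s_neq1 : s != 1.
  by apply: contraNneq n23 => s1; apply/eqP/GLval_inj; rewrite eX3 s1 scale1r.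
have M_neq0 : M != 0 by apply: contraNneq n2 => M0; apply/eqP/GLval_inj; rewrite eX2 M0 addr0.
have trM : \tr M = 0 by rewrite /M linearB /= -!/(trG _) trG_inv // t2 subrr.
have d2 : \det (W + M) = 1 by rewrite -eX2 SL_det.
have d3 : \det (W + s *: M) = 1 by rewrite -eX3 SL_det.
have [detM trXM] := pencil_isotropic xSL s_neq0 s_neq1 d2 d3.
clearbody M.
have XMM : GLval x *m M *m M = 0.
  rewrite -mulmxA; move: trM detM; rewrite trace2E det2E => trM detM.
  rewrite (_ : M *m M = 0) ?mulmx0 //.
  apply: matrix2P; rewrite !mulmx2E !mxE; split.
  - by apply: (eq_lin2 (k1 := M 0 0) (k2 := - 1) trM detM); ring.
  - by apply: (eq_lin1 (k := M 0 1) trM); ring.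
  - by apply: (eq_lin1 (k := M 1 0) trM); ring.
  by apply: (eq_lin2 (k1 := M 1 1) (k2 := - 1) trM detM); ring.
apply: (nilpotent_share M_neq0) => //; rewrite GL_MxE.
  by rewrite eX2 mulmxDr mulmxDl XMM GLmulxV mul1mx addr0.
by rewrite eX3 mulmxDr mulmxDl -scalemxAr -scalemxAl XMM GLmulxV mul1mx scaler0 addr0.
Qed.

(** Since [y^-1 * x * x2 = y2] has the trace of [x2], the differences [y^-1 - x^-1] and
    [z^-1 - x^-1] are traceless and orthogonal to [x * x2] and [x * x3]. Either they are
    proportional, and then an affine line meets SL_2 in three points and its direction is nilpotent;
    or [x * x2], [x * x3] and 1 are dependent, which is [dependent_share]. *)
Lemma fibre_share x x2 x3 y y2 y3 z z2 z3 :
  x \in SL -> x2 \in SL -> x3 \in SL -> y \in SL -> z \in SL -> trG x != 0 ->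
  {in [:: x2; x3; y; y2; y3; z; z2; z3], forall g, trG g = trG x} ->
  y != x -> z != x -> y != z ->
  (y * y2 = x * x2)%g -> (y * y3 = x * x3)%g ->
  (z * z2 = x * x2)%g -> (z * z3 = x * x3)%g ->
  x2 != x^-1%g -> x3 != x^-1%g -> x2 != x3 -> share_line3 x x2 x3.
Proof.
move=> xSL x2SL x3SL ySL zSL t_neq0 tr nyx nzx nyz ey2 ey3 ez2 ez3 n2 n3 n23.
have trI g : g \in SL -> \tr (GLval g^-1%g) = trG g by exact: trG_inv.
set W := GLval x^-1%g.
have trW : \tr W = trG x by rewrite trI.
pose M := GLval y^-1%g - W; pose N := GLval z^-1%g - W.
have eY : GLval y^-1%g = W + M by rewrite addrC subrK.
have eZ : GLval z^-1%g = W + N by rewrite addrC subrK.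
have trM : \tr M = 0.
  by rewrite linearB /= trW trI // tr ?subrr // !inE eqxx ?orbT.
have trN : \tr N = 0.
  by rewrite linearB /= trW trI // tr ?subrr // !inE eqxx ?orbT.
have perp a b c : (a * b = x * c)%g -> trG b = trG c ->
    \tr ((GLval a^-1%g - W) *m GLval (x * c)%g) = 0.
  move=> e tbc; rewrite mulmxBl -!GL_MxE mulKg -e mulKg linearB /=.
  by rewrite -/(trG b) -/(trG c) tbc subrr.
have M_neq0 : M != 0.
  by apply: contraNneq nyx => M0; apply/eqP/invg_inj/GLval_inj; rewrite eY M0 addr0.
have N_neq0 : N != 0.
  by apply: contraNneq nzx => M0; apply/eqP/invg_inj/GLval_inj; rewrite eZ M0 addr0.
have pM2 : \tr (M *m GLval (x * x2)%g) = 0.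
  by apply: perp ey2 _; rewrite !tr // !inE eqxx ?orbT.
have pM3 : \tr (M *m GLval (x * x3)%g) = 0.
  by apply: perp ey3 _; rewrite !tr // !inE eqxx ?orbT.
have pN2 : \tr (N *m GLval (x * x2)%g) = 0.
  by apply: perp ez2 _; rewrite !tr // !inE eqxx ?orbT.
have pN3 : \tr (N *m GLval (x * x3)%g) = 0.
  by apply: perp ez3 _; rewrite !tr // !inE eqxx ?orbT.
have [[s eN]|[a [b [c [bc e]]]]] := traceless_perp M_neq0 trM trN pM2 pM3 pN2 pN3; last first.
  by apply: (dependent_share xSL x2SL x3SL t_neq0 _ _ n2 n3 n23 bc e);
    rewrite tr // !inE eqxx ?orbT.
have s_neq0 : s != 0 by apply: contraNneq N_neq0 => s0; rewrite eN s0 scale0r.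
have s_neq1 : s != 1.
  apply: contraNneq nyz => s1; apply/eqP/invg_inj/GLval_inj.
  by rewrite eY eZ eN s1 scale1r.
have [detM trXM] : \det M = 0 /\ \tr (GLval x *m M) = 0.
  apply: (pencil_isotropic xSL s_neq0 s_neq1).
    by rewrite -eY; exact: SL_det (SL_V ySL).
  by rewrite -eN -eZ; exact: SL_det (SL_V zSL).
by apply: (nilpotent_share M_neq0) => //; rewrite mxtrace_mulC.
Qed.
End SL.

Lemma leq_card_fibres (aT rT : finType) (f : aT -> rT) (A : {set aT}) (B : {set rT}) k :
  {in A, forall x, f x \in B} ->
  {in B, forall y, #|[set x in A | f x == y]| <= k}%N -> (#|A| <= #|B| * k)%N.
Proof.
move=> fAB fibre; rewrite -sum1_card (partition_big f [in B]) //=.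
rewrite -sum_nat_const; apply: leq_sum => y yB.
apply: leq_trans (fibre y yB); rewrite -sum1_card leq_eqVlt; apply/orP; left.
by apply/eqP/eq_bigl => x; rewrite inE.
Qed.

Lemma leq_card_in_inj (aT rT : finType) (f : aT -> rT) (A : {set aT}) (B : {set rT}) :
  {in A, forall x, f x \in B} -> {in A &, injective f} -> (#|A| <= #|B|)%N.
Proof.
move=> fAB finj; rewrite -(card_in_imset finj); apply: subset_leq_card.
by apply/subsetP=> _ /imsetP[x xA ->]; exact: fAB.
Qed.

Lemma card_quadratic_roots (F : finFieldType) (t : F) :
  (#|[set a : F | (a ^+ 2 - t * a + 1 == 0)%R]| <= 2)%N.
Proof.
set r := [set a | _]; have [->|[a]] := set_0Vmem r; first by rewrite cards0.
rewrite inE => /eqP ea; apply: (@leq_trans #|[set a; t - a]|); last first.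
  by rewrite cards2; case: (_ != _).
apply: subset_leq_card; apply/subsetP=> b; rewrite !inE => /eqP eb.
have : (b - a) * (b - (t - a)) == 0.
  by apply/eqP; apply: (eq_lin2 (k1 := -1) (k2 := 1) ea eb); ring.
by rewrite mulf_eq0 !subr_eq0.
Qed.

Section ClassBound.
Variable F : finFieldType.
Implicit Types (x y z g : {'GL_2[F]}) (v w : 'cV[F]_2) (A X : {set {'GL_2[F]}}).

Definition fixer v : {set {'GL_2[F]}} := [set g in SL F | GLval g *m v == v].

Lemma SL_eigenvalue x v a : x \in SL F -> v != 0 -> GLval x *m v = a *: v ->
  a ^+ 2 - trG x * a + 1 = 0.
Proof.
move=> /SL_det; rewrite det2E /trG trace2E => dx v_neq0 /matrixP e.
have := e 0 0; have := e 1 0; rewrite !mulmx2E !mxE => e1 e0.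
case: (colvec2_neq0 v_neq0) => nz; apply: (mulfI nz).
  by apply: (eq_lin3 (k1 := GLval x 1 1 - a) (k2 := - GLval x 0 1) (k3 := - v 0 0) e0 e1 dx); ring.
by apply: (eq_lin3 (k1 := - GLval x 1 0) (k2 := GLval x 0 0 - a) (k3 := - v 1 0) e0 e1 dx); ring.
Qed.

Lemma SL_eigenspace x v w a : x \in SL F -> trG x ^+ 2 != 4 -> v != 0 ->
  GLval x *m v = a *: v -> GLval x *m w = a *: w -> exists c, w = c *: v.
Proof.
move=> /SL_det; rewrite /trG trace2E => dx t_neq v_neq0 ev ew.
apply: cross_eq0 => //; apply: contraNeq t_neq => nz.
have ex : GLval x = a%:M.
  by apply: (mul_cross_inj nz); rewrite ?ev ?ew mul_scalar_mx.
move: dx; rewrite ex det_scalar !mxE /= !mulr1n => dx; apply/eqP.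
by apply: (eq_lin1 (k := 4) dx); ring.
Qed.

(** Sort the [y] by the eigenvalues of [x] and [y] on a common line, at most 4 pairs. The eigenvalue
    of [x] determines the line, [x] having one-dimensional eigenspaces, so two [y] of one sort
    differ by an element fixing a vector. *)
Lemma card_share_line x X u : x \in SL F -> x \in X -> trG x ^+ 2 != 4 ->
  {in X, forall y, y \in SL F /\ trG y = trG x} ->
  (forall v, v != 0 -> (#|(X^-1 * X)%g :&: fixer v| <= u)%N) ->
  (#|[set y in X | share_line x y]| <= 4 * u)%N.
Proof.
move=> xSL xX t_neq XP fixX.
pose r := [set a : F | a ^+ 2 - trG x * a + 1 == 0].
pose c y (p : F * F) :=
  [exists v : 'cV_2, [&& v != 0, GLval x *m v == p.1 *: v & GLval y *m v == p.2 *: v]].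
(* The default pair is never reached when [x] and [y] share a line, by [cf]. *)
pose f y := odflt (0, 0) [pick p | c y p].
have cf y : share_line x y -> c y (f y).
  rewrite /f; case: pickP => //= none /existsP[v].
  case/and3P=> v_neq0 /existsP[a ea] /existsP[b eb].
  by have /existsP[] := none (a, b); exists v; rewrite v_neq0 ea.
apply: (@leq_trans (#|setX r r| * u)); last first.
  rewrite cardsX leq_mul2r (leq_mul (card_quadratic_roots _) (card_quadratic_roots _)).
  by rewrite orbT.
apply: (leq_card_fibres (f := f)) => [y|p _].
  rewrite inE => /andP[yX /cf/existsP[v /and3P[v_neq0 /eqP ex /eqP ey]]].
  have [ySL try] := XP _ yX.
  rewrite !inE (SL_eigenvalue xSL v_neq0 ex) -try.
  by rewrite (SL_eigenvalue ySL v_neq0 ey) eqxx.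
set Y := [set y in _ | _]; have [->|[y0]] := set_0Vmem Y; first by rewrite cards0.
rewrite !inE => /andP[/andP[y0X /cf/existsP[v vP]] /eqP e]; move: vP; rewrite e.
case/and3P=> v_neq0 /eqP ex /eqP ey0.
have [y0SL _] := XP _ y0X.
have p2_neq0 : p.2 != 0.
  apply: contra_neq v_neq0 => p20; apply/eqP.
  by rewrite -(GLmul_eq0 y0) ey0 p20 scale0r.
apply: leq_trans (fixX v v_neq0); rewrite -(card_lcoset Y y0^-1).
apply: subset_leq_card; apply/subsetP=> g; rewrite mem_lcoset invgK.
move: (y0 * g)%g (mulKg y0 g) => y <- {g}.
case/setIdP=> /setIdP[yX /cf/existsP[w wP]] /eqP e'; move: wP; rewrite e'.
case/and3P=> w_neq0 /eqP ex' /eqP ey.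
have [ySL _] := XP _ yX.
apply/setIP; split; first by rewrite mem_mulg // mem_invg invgK.
apply/setIdP; split; first by rewrite groupM ?groupV.
have [b eb] := SL_eigenspace xSL t_neq w_neq0 ex' ex.
rewrite GL_MxE -mulmxA eb -scalemxAr ey.
rewrite scalerA mulrC -scalerA -eb -ey0 mulmxA.
by rewrite GLmulVx mul1mx.
Qed.

(* The map [(x, y, z) |-> (x * y, x * z)] on [X^3] has fibres of size at most 2:
   a fibre is cut out by three linear equations (traces) and one quadric
   (determinant), and it is large only for triples lying in a common Borel
   subgroup or with a coincidence among [x^-1], [y], [z]. *)
Lemma class_bound X t u : t != 0 -> t ^+ 2 != 4 ->
  {in X, forall y, y \in SL F /\ trG y = t} ->
  (forall v, v != 0 -> (#|(X^-1 * X)%g :&: fixer v| <= u)%N) ->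
  (#|X| ^ 3 <= 2 * #|(X * X)%g| ^ 2 + 3 * #|X| ^ 2 + 16 * u ^ 2 * #|X|)%N.
Proof.
move=> t_neq0 t_neq XP fixX.
pose T := setX X (setX X X).
pose bad1 (p : {'GL_2[F]} * ({'GL_2[F]} * {'GL_2[F]})) := p.2.1 == p.1^-1%g.
pose bad2 (p : {'GL_2[F]} * ({'GL_2[F]} * {'GL_2[F]})) := p.2.2 == p.1^-1%g.
pose bad3 (p : {'GL_2[F]} * ({'GL_2[F]} * {'GL_2[F]})) := p.2.1 == p.2.2.
pose bad4 (p : {'GL_2[F]} * ({'GL_2[F]} * {'GL_2[F]})) := share_line3 p.1 p.2.1 p.2.2.
pose good p := ~~ [|| bad1 p, bad2 p, bad3 p | bad4 p].
have cardT : #|T| = (#|X| ^ 3)%N by rewrite !cardsX !expnS expn0 muln1.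
have sub : T \subset [set p in T | good p] :|: ([set p in T | bad1 p] :|:
    ([set p in T | bad2 p] :|: ([set p in T | bad3 p] :|: [set p in T | bad4 p]))).
  apply/subsetP=> p pT; rewrite !in_setU ![p \in [set _ in T | _]]inE pT /good /=.
  by case: (bad1 p); case: (bad2 p); case: (bad3 p); case: (bad4 p).
(* In each of the first three exceptional cases two coordinates determine the third. *)
have card1 : (#|[set p in T | bad1 p]| <= #|setX X X|)%N.
  apply: (leq_card_in_inj (f := fun p => (p.1, p.2.2))) => [[x [y z]]|].
    by rewrite !inE /= => /andP[/and3P[-> _ ->]].
  move=> [x [y z]] [x' [y' z']]; rewrite !inE /bad1 /= => /andP[_ /eqP->] /andP[_ /eqP->].
  by case=> -> ->.
have card2 : (#|[set p in T | bad2 p]| <= #|setX X X|)%N.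
  apply: (leq_card_in_inj (f := fun p => (p.1, p.2.1))) => [[x [y z]]|].
    by rewrite !inE /= => /andP[/and3P[-> ->]].
  move=> [x [y z]] [x' [y' z']]; rewrite !inE /bad2 /= => /andP[_ /eqP->] /andP[_ /eqP->].
  by case=> -> ->.
have card3 : (#|[set p in T | bad3 p]| <= #|setX X X|)%N.
  apply: (leq_card_in_inj (f := fun p => (p.1, p.2.1))) => [[x [y z]]|].
    by rewrite !inE /= => /andP[/and3P[-> ->]].
  move=> [x [y z]] [x' [y' z']]; rewrite !inE /bad3 /= => /andP[_ /eqP<-] /andP[_ /eqP<-].
  by case=> -> ->.
(* For fixed [x], both [y] and [z] share a line with [x], so each has at most 4 u values. *)
have card4 : (#|[set p in T | bad4 p]| <= #|X| * (4 * u) ^ 2)%N.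
  apply: (leq_card_fibres (f := fst)) => [[x [y z]]|x xX].
    by rewrite !inE /= => /andP[/andP[]].
  have [xSL trx] := XP _ xX.
  have := card_share_line xSL xX; rewrite trx => /(_ _ t_neq XP fixX).
  set Y := [set y in X | _] => leY.
  apply: (@leq_trans #|setX Y Y|); last by rewrite cardsX -mulnn leq_mul.
  apply: (leq_card_in_inj (f := snd)) => [[x' [y z]]|[x' p] [x'' q]].
    rewrite !inE /bad4 /= => /andP[/andP[/and3P[_ yX zX] /existsP[v vP]] /eqP ex].
    move: vP; rewrite ex => /and4P[v_neq0 vx vy vz].
    rewrite yX zX; apply/andP; split; apply/existsP; exists v.
      by rewrite v_neq0 vx.
    by rewrite v_neq0 vx.
  by rewrite !inE /= => /andP[_ /eqP->] /andP[_ /eqP->] ->.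
have card0 : (#|[set p in T | good p]| <= #|setX (X * X)%g (X * X)%g| * 2)%N.
  apply: (leq_card_fibres (f := fun p => (p.1 * p.2.1, p.1 * p.2.2)%g)) => [[x [y z]]|[a b] _].
    by rewrite !inE /= => /andP[/and3P[xX yX zX] _]; rewrite !mem_mulg.
  rewrite leqNgt; apply/negP=> /card_gt2P[[x [x2 x3]] [[y [y2 y3]] [[z [z2 z3]]]]].
  rewrite !inE -!pair_eqE /= => -[[]].
  case/andP=> /andP[/and3P[xX x2X x3X] gx] /andP[/eqP ex2 /eqP ex3].
  case/andP=> /andP[/and3P[yX y2X y3X] _] /andP[/eqP ey2 /eqP ey3].
  case/andP=> /andP[/and3P[zX z2X z3X] _] /andP[/eqP ez2 /eqP ez3].
  case=> nxy nyz nzx; move: gx; rewrite /good /bad1 /bad2 /bad3 /bad4 /= !negb_or.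
  case/and4P=> n2 n3 n23 /negP; apply.
  have det g h g2 h2 g3 h3 : (g * g2 = a)%g -> (g * g3 = b)%g -> (h * h2 = a)%g ->
      (h * h3 = b)%g -> ~~ ((g == h) && ((g2, g3) == (h2, h3))) -> g != h.
    move=> eg2 eg3 eh2 eh3; apply: contraNneq => e; rewrite -e in eh2 eh3 *.
    have -> : g2 = h2 by apply: (mulgI g); rewrite eg2 eh2.
    have -> : g3 = h3 by apply: (mulgI g); rewrite eg3 eh3.
    by rewrite !eqxx.
  have trX g : g \in X -> trG g = trG x.
    by move=> gX; rewrite (XP _ gX).2 (XP _ xX).2.
  have inSL g : g \in X -> g \in SL F by move=> /XP[].
  apply: (fibre_share (y := y) (y2 := y2) (y3 := y3) (z := z) (z2 := z2) (z3 := z3));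
    rewrite ?inSL ?(XP _ xX).2 // ?ey2 ?ey3 ?ez2 ?ez3 ?ex2 ?ex3 //.
  - by move=> g; rewrite !inE => /or4P[|||/or4P[|||/orP[]]] /eqP->; rewrite trX // (XP _ xX).2.
  - by rewrite eq_sym; apply: det nxy.
  - by apply: det nzx.
  by apply: det nyz.
rewrite !cardsX in card0 card1 card2 card3; rewrite -cardT.
apply: leq_trans (subset_leq_card sub) _.
apply: leq_trans (leq_card_setU _ _).1 _.
apply: leq_trans (leq_add card0 (leq_trans (leq_card_setU _ _).1 (leq_add card1 _))) _.
  apply: leq_trans (leq_card_setU _ _).1 (leq_add card2 _).
  exact: leq_trans (leq_card_setU _ _).1 (leq_add card3 card4).
by rewrite expnMn; lia.
Qed.
End ClassBound.

Section Powers.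
Variable gT : finGroupType.
Implicit Types A : {set gT}.

Lemma expg1_mem A i : 1%g \in A -> 1%g \in (A ^+ i)%g.
Proof.
move=> A1; elim: i => [|i IHi]; first by rewrite expg0 set11.
by rewrite expgS -(mulg1 1%g) mem_mulg.
Qed.

Lemma expg_subset A i j : 1%g \in A -> (i <= j)%N -> (A ^+ i)%g \subset (A ^+ j)%g.
Proof.
move=> A1 /subnKC <-; rewrite expgD -{1}(mulg1 (A ^+ i)%g) mulgS // sub1set.
exact: expg1_mem.
Qed.

Lemma expgV_set A i : (A^-1)%g = A -> ((A ^+ i)^-1)%g = (A ^+ i)%g.
Proof.
move=> AV; elim: i => [|i IHi]; first by rewrite expg0 invg1.
by rewrite [in LHS]expgS invMg IHi AV expgSr.
Qed.

Lemma expg_sub_group A (G : {group gT}) i : A \subset G -> (A ^+ i)%g \subset G.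
Proof.
move=> sAG; elim: i => [|i IHi]; first by rewrite expg0 sub1set group1.
by rewrite expgS mul_subG.
Qed.

Lemma mem_expgM A x y k i : x \in (A ^+ k)%g -> y \in A ->
  (x ^+ i * y)%g \in (A ^+ (k * i).+1)%g.
Proof.
move=> xA yA; rewrite expgSr mem_mulg // expgM.
elim: i => [|i IHi]; first by rewrite !expg0 set11.
by rewrite !expgS mem_mulg.
Qed.
End Powers.

(** * Generating sets of SL_2, fixers of vectors and tori *)

Section Generation.
Variable F : finFieldType.
Implicit Types (x y z g : {'GL_2[F]}) (v w : 'cV[F]_2) (A X Y : {set {'GL_2[F]}}).

Lemma SL_of_matrix (M : 'M[F]_2) : \det M = 1 -> exists2 g, g \in SL F & GLval g = M.
Proof.
move=> detM; have uM : M \is a GRing.unit.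
  by rewrite -[_ \is a _]/(M \in unitmx) unitmxE detM unitr1.
by exists (Sub M uM); rewrite ?inE ?SubK ?detM.
Qed.

Definition shear12 (a : F) : 'M[F]_2 := 1%:M + a *: delta_mx 0 1.
Definition shear21 (a : F) : 'M[F]_2 := 1%:M + a *: delta_mx 1 0.

Lemma shear12E a : [/\ shear12 a 0 0 = 1, shear12 a 0 1 = a, shear12 a 1 0 = 0 & shear12 a 1 1 = 1].
Proof. by rewrite !mxE /= ?mulr1n ?mulr0n ?mulr1 ?mulr0 ?addr0 ?add0r. Qed.

Lemma shear21E a : [/\ shear21 a 0 0 = 1, shear21 a 0 1 = 0, shear21 a 1 0 = a & shear21 a 1 1 = 1].
Proof. by rewrite !mxE /= ?mulr1n ?mulr0n ?mulr1 ?mulr0 ?addr0 ?add0r. Qed.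

Lemma det_shear12 a : \det (shear12 a) = 1.
Proof. by have [e00 e01 e10 e11] := shear12E a; rewrite det2E e00 e01 e10 e11; ring. Qed.

Lemma det_shear21 a : \det (shear21 a) = 1.
Proof. by have [e00 e01 e10 e11] := shear21E a; rewrite det2E e00 e01 e10 e11; ring. Qed.

Lemma SL_irreducible v : v != 0 -> exists2 g, g \in SL F & ~~ eigenG g v.
Proof.
move=> v_neq0; have [g gSL eg] := SL_of_matrix (det_shear12 1).
have [h hSL eh] := SL_of_matrix (det_shear21 1).
have [|ng] := boolP (eigenG g v); last by exists g.
have [|nh] := boolP (eigenG h v); last by exists h.
move=> /eigenGP[b /(congr1 (cross v))]; rewrite crossZ eh.
move=> + /eigenGP[a /(congr1 (cross v))]; rewrite crossZ eg /cross !mulmx2E.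
have [-> -> -> ->] := shear12E 1; have [-> -> -> ->] := shear21E 1.
move=> e1 e2; have [nz|nz] := colvec2_neq0 v_neq0; case/eqP: nz; apply/eqP.
  by rewrite -sqrf_eq0; apply/eqP; apply: (eq_lin1 (k := 1) e1); ring.
by rewrite -sqrf_eq0; apply/eqP; apply: (eq_lin1 (k := -1) e2); ring.
Qed.

Lemma generate_not_eigen A v : <<A>>%g = SL F -> v != 0 ->
  exists2 g, g \in A & ~~ eigenG g v.
Proof.
move=> genA v_neq0; apply/exists_inP; apply: contraT => /exists_inPn none.
have sub : A \subset Group (eigenG_group_set v).
  by apply/subsetP=> g /none; rewrite inE negbK.
have [g] := SL_irreducible v_neq0.
by rewrite -genA => /(subsetP (etrans (gen_subG _ _) sub)); rewrite inE => ->.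
Qed.

(** The map [(g, h)] to [g * a * h] is injective on pairs fixing [v]: if two pairs agree,
    [g'^-1 * g] fixes both [v] and [a v], which form a basis. *)
Lemma card_fixer_sqr Y a v : v != 0 -> ~~ eigenG a v ->
  (#|Y :&: fixer v| ^ 2 <= #|(Y * [set a] * Y)%g|)%N.
Proof.
move=> v_neq0 nav; rewrite -mulnn -cardsX.
have nz : cross v (GLval a *m v) != 0.
  by apply: contra nav => /eqP /(cross_eq0 v_neq0) ?; apply/eigenGP.
apply: (leq_card_in_inj (f := fun p => (p.1 * a * p.2)%g)).
  move=> [g h]; rewrite !in_setX !in_setI => /andP[/andP[gY _] /andP[hY _]].
  by rewrite !mem_mulg ?set11.
move=> [g h] [g' h'] /setXP[/setIP[_ /setIdP[_ /eqP fg]] /setIP[_ /setIdP[_ /eqP fh]]].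
move=> /setXP[/setIP[_ /setIdP[_ /eqP fg']] /setIP[_ /setIdP[_ /eqP fh']]] /= e.
have ega : (g'^-1 * g * a)%g = (a * (h' * h^-1))%g.
  by apply: (mulgI g'); rewrite !mulgA mulgV mul1g -e mulgK.
have fhh : GLval (h' * h^-1)%g *m v = v.
  by rewrite GL_MxE -mulmxA -{1}fh (mulmxA (GLval h^-1%g)) GLmulVx mul1mx.
have eg : (g'^-1 * g)%g = 1%g.
  apply: GLval_inj; rewrite GL_1E; apply: (mul_cross_inj nz).
    by rewrite GL_MxE -mulmxA fg -{1}fg' mulmxA GLmulVx mul1mx.
  have -> : GLval (g'^-1 * g)%g *m (GLval a *m v) = GLval (g'^-1 * g * a)%g *m v.
    by rewrite [in RHS]GL_MxE -mulmxA.
  by rewrite ega GL_MxE -mulmxA fhh mul1mx.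
have {}eg : g = g' by apply: (mulgI g'^-1%g); rewrite eg mulVg.
by move: e; rewrite eg => /mulgI->.
Qed.

(** The exponent makes room for [(X^-1 * X) * a * (X^-1 * X)], with [a] in [A] moving the line of
    [v]; 21 is the sum 2 + 3 + 16 of the constants of [class_bound]. *)
Lemma card_class_trace A m t : 1%g \in A -> (A^-1)%g = A -> <<A>>%g = SL F ->
    t != 0 -> t ^+ 2 != 4 ->
  (#|[set x in (A ^+ m)%g | trG x == t]| ^ 3 <= 21 * #|(A ^+ (4 * m).+1)%g| ^ 2)%N.
Proof.
move=> A1 AV genA t_neq0 t_neq; set X := [set x in _ | _].
have sASL : A \subset SL F by rewrite -genA subset_gen.
have sXA : X \subset (A ^+ m)%g by apply/subsetP=> x; rewrite inE => /andP[].
have XP : {in X, forall x, x \in SL F /\ trG x = t}.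
  move=> x; rewrite inE => /andP[xA /eqP ->]; split=> //.
  exact: subsetP (expg_sub_group m sASL) x xA.
set N := #|(A ^+ (4 * m).+1)%g|.
have fixX v : v != 0 -> (#|(X^-1 * X)%g :&: fixer v| ^ 2 <= N)%N.
  move=> v_neq0; have [a aA nav] := generate_not_eigen genA v_neq0.
  apply: leq_trans (card_fixer_sqr _ v_neq0 nav) (subset_leq_card _).
  have sXX : (X^-1 * X)%g \subset (A ^+ (m + m))%g.
    by rewrite expgD mulgSS // -(expgV_set m AV) invSg.
  rewrite (_ : (4 * m).+1 = (m + m) + 1 + (m + m))%N; last lia.
  by rewrite !expgD expg1 -expgD !mulgSS ?sub1set.
pose f v := #|(X^-1 * X)%g :&: fixer v|; pose u := (\max_(v : 'cV[F]_2 | (v != 0)%R) f v)%N.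
have u2 : (u ^ 2 <= N)%N.
  apply: (big_ind (fun k => k ^ 2 <= N)%N) => // k l lek lel.
  by rewrite /maxn; case: ifP.
have fixu v : v != 0 -> (f v <= u)%N by move=> v_neq0; apply: leq_bigmax_cond.
have leX : (#|X| <= N)%N.
  apply: leq_trans (subset_leq_card sXA) (subset_leq_card _).
  by apply: expg_subset => //; lia.
have leXX : (#|(X * X)%g| <= N)%N.
  apply/subset_leq_card/(subset_trans (mulgSS sXA sXA)); rewrite -expgD.
  by apply: expg_subset => //; lia.
apply: leq_trans (class_bound t_neq0 t_neq XP fixu) _.
have := leq_mul leX leX; have := leq_mul leXX leXX; have := leq_mul u2 leX.
by move: #|X| #|(X * X)%g| (u ^ 2)%N => n l k ? ? ?; rewrite -!mulnn; lia.
Qed.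

Lemma nonscalar_trace x : x \in SL F -> trG x ^+ 2 != 4 -> ~~ is_scalar_mx (GLval x).
Proof.
move=> /SL_det dx; apply: contra => /is_scalar_mxP[a e].
move: dx; rewrite /trG e det_scalar mxtrace_scalar /= => dx; apply/eqP.
by apply: (eq_lin1 (k := 4) dx); ring.
Qed.

Lemma cent1_mulmx x y : y \in 'C[x]%g -> GLval y *m GLval x = GLval x *m GLval y.
Proof. by move/cent1P => e; rewrite -(GL_MxE y x) -(GL_MxE x y) e. Qed.

(** Both elements have the form a + b x. Once the trace is given, determinant 1 fixes b^2, because
    [4 - trG x ^+ 2] is nonzero; the two signs of b give inverse elements. *)
Lemma cent1_trace x y y' : (2 : F) != 0 -> x \in SL F -> trG x ^+ 2 != 4 ->
  y \in SL F -> y' \in SL F -> y \in 'C[x]%g -> y' \in 'C[x]%g -> trG y = trG y' ->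
  y' = y \/ y' = y^-1%g.
Proof.
move=> two xSL t_neq ySL y'SL /cent1_mulmx cy /cent1_mulmx cy' try.
have x_nsc := nonscalar_trace xSL t_neq.
have [a [b ey]] := commute_span x_nsc cy.
have [a' [b' ey']] := commute_span x_nsc cy'.
have dx := SL_det xSL; have dy := SL_det ySL; have dy' := SL_det y'SL.
have trE c d : \tr (c%:M + d *: GLval x) = 2 * c + d * trG x.
  by rewrite /trG !trace2E !mxE /= !mulr1n; ring.
have detE c d : \det (c%:M + d *: GLval x) = c ^+ 2 + c * d * trG x + d ^+ 2.
  rewrite det2E !mxE /= ?mulr1n ?mulr0n /trG trace2E.
  by rewrite det2E in dx; apply: (eq_lin1 (k := d ^+ 2) dx); ring.
have tr_y : trG y = 2 * a + b * trG x by rewrite /trG ey trE.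
have tr_y' : trG y' = 2 * a' + b' * trG x by rewrite /trG ey' trE.
rewrite ey detE in dy; rewrite ey' detE in dy'.
rewrite tr_y tr_y' in try.
have nz : 4 - trG x ^+ 2 != 0 by rewrite subr_eq0 eq_sym.
have : (b' - b) * (b' + b) == 0.
  rewrite -subr_sqr subr_eq0; apply/eqP; apply: (mulfI nz).
  apply: (eq_lin3 (k1 := -4) (k2 := 4) (k3 := 2 * a + b * trG x + 2 * a' + b' * trG x) dy dy' try).
  by ring.
rewrite mulf_eq0 subr_eq0 addr_eq0 => /orP[]/eqP eb; [left|right]; apply: GLval_inj.
  rewrite ey ey' eb; congr (_%:M + _); apply: (mulfI two).
  by rewrite eb in try; apply: (eq_lin1 (k := -1) try); ring.
have ea : a' = a + b * trG x.
  by apply: (mulfI two); rewrite eb in try; apply: (eq_lin1 (k := -1) try); ring.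
rewrite (SL_inv ySL) tr_y ey' ey ea eb.
by apply: matrix2P; rewrite !mxE /= ?mulr1n ?mulr0n; split; ring.
Qed.

Lemma card_cent1_trace x t : (2 : F) != 0 -> x \in SL F -> trG x ^+ 2 != 4 ->
  (#|[set y in SL F :&: 'C[x]%g | trG y == t]| <= 2)%N.
Proof.
move=> two xSL t_neq; set Y := [set _ in _ | _].
have [->|[y0 y0Y]] := set_0Vmem Y; first by rewrite cards0.
move: (y0Y) => /setIdP[/setIP[y0SL y0C] /eqP try0].
apply: (@leq_trans #|[set y0; y0^-1%g]|); last by rewrite cards2; case: (_ != _).
apply/subset_leq_card/subsetP=> y /setIdP[/setIP[ySL yC] /eqP try].
have := cent1_trace two xSL t_neq y0SL ySL y0C yC; rewrite try0 try => /(_ erefl).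
by case=> ->; rewrite !inE eqxx ?orbT.
Qed.

Lemma card_GL2_SL : (#|F| * (#|F| ^ 2 - 1) <= #|SL F|)%N.
Proof.
have q_gt1 : (1 < #|F|)%N by exact: card_finNzRing_gt1.
have : (#|'GL_2[F]%g| <= #|[set~ (0%R : F)]| * #|SL F|)%N.
  apply: (leq_card_fibres (f := fun g => \det (GLval g))) => [g _|d _].
    by rewrite !inE GL_det.
  set Y := [set _ in _ | _]; have [->|[g0]] := set_0Vmem Y; first by rewrite cards0.
  rewrite inE => /andP[_ /eqP eg0]; rewrite -(card_lcoset Y g0^-1).
  apply: subset_leq_card; apply/subsetP=> h; rewrite mem_lcoset invgK inE => /andP[_ /eqP e].
  rewrite inE; apply/eqP; apply: (mulfI (GL_det g0)).
  by rewrite -det_mulmx -GL_MxE e eg0 mulr1.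
rewrite card_GL_2 cardsC1; move: #|F| q_gt1 => q q_gt1.
have -> : (q * q.-1 ^ 2 * q.+1 = q.-1 * (q * (q ^ 2 - 1)))%N.
  case: q q_gt1 => // q _ /=.
  have -> : (q.+1 ^ 2 - 1 = q * q.+2)%N by rewrite -mulnn; lia.
  by rewrite -mulnn; lia.
by rewrite leq_pmul2l //; case: q q_gt1 => [|[|q]].
Qed.

End Generation.

(** * The pivot argument *)

Section GoodTrace.
Variable F : finFieldType.
Hypotheses (two_neq0 : (2 : F) != 0) (three_neq0 : (3 : F) != 0).
Implicit Types (x y z g : {'GL_2[F]}) (v w : 'cV[F]_2) (A X Y : {set {'GL_2[F]}}).

(** By Cayley-Hamilton [x + x^-1] is the scalar [trG x]; iterated, this is a linear recursion for
    the traces of [x ^+ i * y]. *)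
Lemma trG_mul x y : x \in SL F -> trG (x * y) = trG x * trG y - trG (x^-1 * y).
Proof.
move=> xSL; have -> : trG (x^-1 * y) = \tr (((trG x)%:M - GLval x) *m GLval y).
  by rewrite /trG GL_MxE SL_inv.
rewrite mulmxBl linearB /= mul_scalar_mx linearZ /= -(GL_MxE x y).
by rewrite -/(trG (x * y)) -/(trG y); ring.
Qed.

Let good x := (trG x != 0) && (trG x ^+ 2 != 4).

Let not_good x : ~~ good x -> trG x ^+ 3 - 4 * trG x = 0.
Proof.
rewrite /good negb_and !negbK => /orP[/eqP->|/eqP e]; first by ring.
by apply: (eq_lin1 (k := trG x) e); ring.
Qed.

(* If [x = e (1 + N)] with [e = 1] or [e = -1] and [N] nilpotent, the traces of
   [x^i y] are, up to sign, in arithmetic progression; the third difference of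
   [t^3 - 4 t] along it is [6 s^3]. *)
Lemma unipotent_good_trace A x : <<A>>%g = SL F -> x \in SL F ->
    ~~ is_scalar_mx (GLval x) -> trG x ^+ 2 = 4 ->
  exists i y, [/\ (i <= 3)%N, y \in A & good (x ^+ i * y)%g].
Proof.
move=> genA xSL x_nsc trx2.
have [e [e1 tre]] : exists e, (e = 1 \/ e = -1) /\ trG x = 2 * e.
  have : (trG x - 2) * (trG x + 2) == 0.
    by apply/eqP; apply: (eq_lin1 (k := 1) trx2); ring.
  rewrite mulf_eq0 subr_eq0 addr_eq0 => /orP[]/eqP->; [exists 1|exists (-1)].
    by split; [left | ring].
  by split; [right | ring].
pose N := GLval x - e%:M.
have N_neq0 : N != 0.
  apply: contraNneq x_nsc => N0; apply/is_scalar_mxP; exists e.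
  by apply/eqP; rewrite -subr_eq0; apply/eqP.
have e2 : e ^+ 2 = 1 by case: e1 => ->; rewrite ?sqrrN expr1n.
have trN : \tr N = 0.
  rewrite linearB /= -/(trG x) mxtrace_scalar /= tre; ring.
have detN : \det N = 0.
  have := SL_det xSL; move: tre; rewrite /trG trace2E !det2E => tr dx.
  rewrite !mxE /= ?mulr1n ?mulr0n.
  by apply: (eq_lin3 (k1 := - e) (k2 := 1) (k3 := - 1) tr dx e2); ring.
have [v v_neq0 vP] := nilpotent_line N_neq0 trN detN.
have [y yA ny] := generate_not_eigen genA v_neq0.
have s_neq0 : \tr (GLval y *m N) != 0.
  by apply: contra ny => /eqP /vP ?; apply/eigenGP.
pose t i := trG (x ^+ i * y)%g.
have trec i : t i.+2 = 2 * e * t i.+1 - t i.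
  by rewrite /t !expgS -!mulgA trG_mul // tre mulKg.
have es : \tr (GLval y *m N) = t 1%N - e * t 0%N.
  rewrite /t expg0 expg1 mul1g mulmxBr linearB /= mul_mx_scalar linearZ /=.
  by rewrite mxtrace_mulC -(GL_MxE x y).
have [/existsP[i gi]|/existsPn none] := boolP [exists i : 'I_4, good (x ^+ i * y)%g].
  by exists i, y; split=> //; rewrite -ltnS.
have f i : (i < 4)%N -> t i ^+ 3 - 4 * t i = 0.
  by move=> lt; apply: not_good; exact: (none (Ordinal lt)).
have f0 := f 0%N isT; have f1 := f 1%N isT; have f2 := f 2%N isT; have f3 := f 3%N isT.
move: s_neq0 f2 f3; rewrite es !trec; move: (t 0%N) (t 1%N) f0 f1 => t0 t1 f0 f1.
move=> s_neq0 f2 f3; case/negP: s_neq0.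
have six : (2 * 3 : F) != 0 by rewrite mulf_neq0.
suff: (t1 - e * t0) ^+ 3 == 0 by rewrite expf_eq0.
apply/eqP; apply: (mulfI six).
case: e1 f2 f3 => -> f2 f3.
  by apply: (eq_lin4 (k1 := -1) (k2 := 3) (k3 := -3) (k4 := 1) f0 f1 f2 f3); ring.
by apply: (eq_lin4 (k1 := 1) (k2 := 3) (k3 := 3) (k4 := 1) f0 f1 f2 f3); ring.
Qed.

(** Commutation with [x] in PGL_2: comparing determinants, the scalar can only be 1 or -1. *)
Definition sign_commute x g :=
  (GLval x *m GLval g == GLval g *m GLval x) || (GLval x *m GLval g == - (GLval g *m GLval x)).

Lemma sign_commuteP x g : reflect
  (exists2 s : F, s = 1 \/ s = -1 & GLval x *m GLval g = s *: (GLval g *m GLval x))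
  (sign_commute x g).
Proof.
apply: (iffP orP) => [[]/eqP e|[s [] -> e]].
- by exists 1; [left | rewrite scale1r].
- by exists (-1); [right | rewrite scaleN1r].
- by left; rewrite e scale1r.
by right; rewrite e scaleN1r.
Qed.

Lemma sign_commute_group_set x : group_set [set g | sign_commute x g].
Proof.
apply/group_setP; split=> [|g h]; rewrite !inE.
  by apply/sign_commuteP; exists 1; [left | rewrite GL_1E mulmx1 mul1mx scale1r].
move=> /sign_commuteP[s s1 es] /sign_commuteP[r r1 er]; apply/sign_commuteP.
exists (s * r).
  by case: s1 => ->; case: r1 => ->; rewrite ?mulN1r ?opprK ?mul1r; [left|right|right|left].
by rewrite !(GL_MxE g h) mulmxA es -scalemxAl -mulmxA er -scalemxAr scalerA mulmxA.
Qed.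

Lemma SL_not_sign_commute x : x \in SL F -> trG x = 0 ->
  exists2 g, g \in SL F & ~~ sign_commute x g.
Proof.
move=> xSL tr0; have [g gSL eg] := SL_of_matrix (det_shear12 (1 : F)).
have [h hSL eh] := SL_of_matrix (det_shear21 (1 : F)).
have [|ng] := boolP (sign_commute x g); last by exists g.
have [|nh] := boolP (sign_commute x h); last by exists h.
move=> /sign_commuteP[s s1 /matrixP es] /sign_commuteP[r r1 /matrixP er].
have := es 0 1; have := es 1 0; have := es 0 0; have := es 1 1.
have := er 0 1; have := er 1 0; have := er 0 0; have := er 1 1.
rewrite !mxE !sum2E eg eh.
have [-> -> -> ->] := shear12E (1 : F); have [-> -> -> ->] := shear21E (1 : F).
move: tr0 (SL_det xSL); rewrite /trG trace2E det2E.
move: (GLval x 0 0) (GLval x 0 1) (GLval x 1 0) (GLval x 1 1) => a b c d tr0 dx.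
move=> r11 r00 r10 r01 s11 s00 s10 s01.
have c0 : c = 0.
  apply: (mulfI two_neq0); case: r1 r00 r10 => -> r00 r10.
    by apply: (eq_lin1 (k := -2) r00); ring.
  by apply: (eq_lin1 (k := 1) r10); ring.
have a0 : a = 0.
  apply: (mulfI two_neq0); case: r1 r00 r01 => -> r00 r01.
    by apply: (eq_lin2 (k1 := 1) (k2 := 1) r01 tr0); ring.
  by apply: (eq_lin2 (k1 := 1) (k2 := -1) r00 c0); ring.
have b0 : b = 0.
  apply: (mulfI two_neq0); case: s1 s00 s01 => -> s00 s01.
    by apply: (eq_lin1 (k := 2) s00); ring.
  by apply: (eq_lin1 (k := 1) s01); ring.
by case/eqP: (oner_neq0 F); rewrite -dx a0 b0 !mul0r subrr.
Qed.

(** If a nonscalar element of [A ^+ 2] has trace 2 or -2, the unipotent case gives [x ^+ i * y] with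
    i <= 3, whence 7 = 2 * 3 + 1. If moreover nothing in [A ^+ 2] is good, nonscalar elements there
    have trace 0; vanishing traces of [a], [b] and [a * b] force [a * b] to be [- b * a] as
    matrices, so [A] would commute up to sign with one nonscalar [a]. *)
Lemma good_trace A : 1%g \in A -> (A^-1)%g = A -> <<A>>%g = SL F ->
  exists2 a, a \in (A ^+ 7)%g & (trG a != 0) && (trG a ^+ 2 != 4).
Proof.
move=> A1 AV genA; have sASL : A \subset SL F by rewrite -genA subset_gen.
have [/exists_inP[x x2 /andP[x_nsc /eqP trx]]|/exists_inPn none2] :=
    boolP [exists x in (A ^+ 2)%g, ~~ is_scalar_mx (GLval x) && (trG x ^+ 2 == 4)].
  have xSL := subsetP (expg_sub_group 2 sASL) x x2.
  have [i [y [le_i yA g]]] := unipotent_good_trace genA xSL x_nsc trx.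
  exists (x ^+ i * y)%g => //.
  have le7 : ((2 * i).+1 <= 7)%N by lia.
  exact: subsetP (expg_subset A1 le7) _ (mem_expgM i x2 yA).
have [/exists_inP[x x2 g]|/exists_inPn none] := boolP [exists x in (A ^+ 2)%g, good x].
  by exists x => //; apply: subsetP x2; apply: expg_subset.
have A2 x : x \in (A ^+ 2)%g -> ~~ is_scalar_mx (GLval x) -> trG x = 0.
  move=> xA2 x_nsc; have := none2 x xA2; have := none x xA2.
  rewrite x_nsc /= /good negb_and negbK => /orP[/eqP//|] /[swap].
  by move/negPf->.
have sA2 x : x \in A -> x \in (A ^+ 2)%g.
  by move=> xA; rewrite -[x]mul1g expgS expg1 mem_mulg.
have [a aA a_nsc] : exists2 a, a \in A & ~~ is_scalar_mx (GLval a).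
  have v_neq0 : (delta_mx 0 0 : 'cV[F]_2) != 0.
    by apply/eqP=> /matrixP/(_ 0 0)/eqP; rewrite !mxE oner_eq0.
  have [a aA na] := generate_not_eigen genA v_neq0; exists a => //.
  apply: contra na => /is_scalar_mxP[c ec]; apply/eigenGP; exists c.
  by rewrite ec mul_scalar_mx.
have tra : trG a = 0 by apply: A2 => //; exact: sA2.
have aSL := subsetP sASL a aA.
have sub : A \subset Group (sign_commute_group_set a).
  apply/subsetP=> b bA; rewrite inE.
  have bSL := subsetP sASL b bA.
  have [/is_scalar_mxP[c ec]|b_nsc] := boolP (is_scalar_mx (GLval b)).
    by rewrite /sign_commute ec mul_scalar_mx mul_mx_scalar eqxx.
  have abA2 : (a * b)%g \in (A ^+ 2)%g by rewrite expgS expg1 mem_mulg.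
  have [/is_scalar_mxP[c ec]|ab_nsc] := boolP (is_scalar_mx (GLval (a * b)%g)).
    have eb : GLval b = c *: GLval a^-1%g.
      by rewrite -[LHS]mul1mx -(GLmulVx a) -mulmxA -(GL_MxE a b) ec mul_mx_scalar.
    by rewrite /sign_commute eb -scalemxAr -scalemxAl GLmulxV GLmulVx eqxx.
  have trb : trG b = 0 by apply: A2 => //; exact: sA2.
  have trab := A2 _ abA2 ab_nsc.
  apply/orP; right; apply/eqP.
  move: tra trb trab; rewrite /trG GL_MxE !trace2E !mulmx2E => tra trb trab.
  apply: matrix2P; rewrite !mulmx2E !mxE !sum2E; split.
  - by apply: (eq_lin3 (k1 := 1) (k2 := - GLval a 1 1) (k3 := GLval b 0 0) trab trb tra); ring.
  - by apply: (eq_lin2 (k1 := GLval a 0 1) (k2 := GLval b 0 1) trb tra); ring.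
  - by apply: (eq_lin2 (k1 := GLval a 1 0) (k2 := GLval b 1 0) trb tra); ring.
  by apply: (eq_lin3 (k1 := 1) (k2 := GLval a 1 1) (k3 := - GLval b 0 0) trab trb tra); ring.
have [g] := SL_not_sign_commute aSL tra.
by rewrite -genA => /(subsetP (etrans (gen_subG _ _) sub)); rewrite inE => ->.
Qed.
End GoodTrace.

(** [Q] stands for q^2 - 1, [C] for the size of a class, [k] for the least torus count over it. As 6
    < k, k <= 7 (k - 6), whence Q k <= 28 L n with 28 = 2 * 7 * 2. *)
Lemma pivot_arith (Q C k m n L : nat) : (Q <= 2 * C)%N -> (C * (k - 6) <= m * 2)%N ->
  (m <= L * n)%N -> (6 < k)%N -> (n <= 21 * L ^ 2 * k ^ 3)%N -> (0 < n)%N ->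
  (Q ^ 3 <= 21 * 28 ^ 3 * L ^ 5 * n ^ 2)%N.
Proof.
move=> leQ leC lem lt6k len n_gt0.
have lek : (Q * k <= 28 * (L * n))%N.
  apply: leq_trans (leq_mul leQ (_ : _ <= 7 * (k - 6))%N) _; lia.
have {}lek : (Q ^ 3 * k ^ 3 <= 28 ^ 3 * (L ^ 3 * n ^ 3))%N.
  by rewrite -!expnMn leq_exp2r.
rewrite -(leq_pmul2r n_gt0).
apply: leq_trans (leq_mul (leqnn _) len) _; rewrite mulnCA.
apply: leq_trans (leq_mul (leqnn _) lek) _.
rewrite -[5%N]/(2 + 3)%N expnD -(mulnA _ (n ^ 2)%N) -expnSr.
by move: (28 ^ 3)%N => c; lia.
Qed.

(** * Torus counts and their spreading to conjugates *)

Section Pivot.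
Variable F : finFieldType.
Hypotheses (two_neq0 : (2 : F) != 0) (three_neq0 : (3 : F) != 0).
Implicit Types (x y z g : {'GL_2[F]}) (A X Y : {set {'GL_2[F]}}).

(** Orbit-stabilizer inside [A]: two elements conjugating [x] to the same element have a quotient in
    [A ^+ 2] that centralizes [x]. *)
Lemma card_le_class_cent1 A m x : (A^-1)%g = A -> x \in (A ^+ m)%g ->
  (#|A| <= #|[set y in (A ^+ m.+2)%g | trG y == trG x]| * #|(A ^+ 2)%g :&: 'C[x]%g|)%N.
Proof.
move=> AV xA; apply: (leq_card_fibres (f := fun b => (x ^ b)%g)) => [b bA|y _].
  rewrite inE trG_conj eqxx andbT conjgE expgS expgSr.
  by rewrite !mem_mulg // -AV mem_invg invgK.
set Y := [set b in A | _]; have [->|[b0]] := set_0Vmem Y; first by rewrite cards0.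
rewrite inE => /andP[b0A /eqP eb0]; rewrite -(card_rcoset Y b0^-1).
apply/subset_leq_card/subsetP=> c; rewrite mem_rcoset invgK inE => /andP[cbA /eqP ec].
apply/setIP; split.
  by rewrite -(mulgK b0 c) expgS expg1 mem_mulg // -AV mem_invg invgK.
rewrite cent1C; apply/cent1P/commgP/conjg_fixP.
by rewrite -(mulgK b0 c) conjgM ec -eb0 conjgK.
Qed.

(** Multiply [(h, a)] to [h * a]: in a fibre [a] determines [h], and quotients of the [a] lie in
    [A ^+ 2] and in [H]. So intersections with a subgroup grow no faster than [A]. *)
Lemma card_setI_growth (gT : finGroupType) (A : {set gT}) (H : {group gT}) k : (A^-1)%g = A ->
  (#|(A ^+ k)%g :&: H| * #|A| <= #|(A ^+ k.+1)%g| * #|(A ^+ 2)%g :&: H|)%N.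
Proof.
move=> AV; rewrite -cardsX.
apply: (leq_card_fibres (f := fun p => (p.1 * p.2)%g)) => [[h a]|y _].
  by case/setXP=> /setIP[hA _] aA; rewrite expgSr mem_mulg.
set Y := [set b in _ | _]; have [->|[[h0 a0]]] := set_0Vmem Y; first by rewrite cards0.
case/setIdP=> /setXP[/setIP[_ h0H] a0A] /eqP /= e0.
apply: (leq_card_in_inj (f := fun p => (p.2 * a0^-1)%g)) => [[h a]|[h a] [h' a']].
  case/setIdP=> /setXP[/setIP[_ hH] aA] /eqP /= e.
  apply/setIP; split; first by rewrite expgS expg1 mem_mulg // -AV mem_invg invgK.
  rewrite -(mulKg h a) e -e0 -!mulgA mulgV mulg1.
  by rewrite groupM ?groupV.
case/setIdP=> /setXP[_ _] /eqP /= e; case/setIdP=> /setXP[_ _] /eqP /= e' /mulIg ea.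
by move: e; rewrite -e' ea => /mulIg->.
Qed.

Lemma cent1_nonscalar_sub x y : ~~ is_scalar_mx (GLval y) -> y \in 'C[x]%g ->
  'C[y]%g \subset 'C[x]%g.
Proof.
move=> y_nsc /cent1_mulmx cxy; apply/subsetP=> z /cent1_mulmx czy.
have [a [b ez]] := commute_span y_nsc czy.
apply/cent1P/GLval_inj; rewrite !GL_MxE ez mulmxDl mulmxDr mul_scalar_mx mul_mx_scalar.
by rewrite -scalemxAl -scalemxAr cxy.
Qed.

Let good y := (trG y != 0) && (trG y ^+ 2 != 4).

(** The torus has at most two elements of each of the traces 0, 2 and -2, whence 6. *)
Lemma card_cent1_good (B : {set {'GL_2[F]}}) x : B \subset SL F ->
  x \in SL F -> trG x ^+ 2 != 4 ->
  (#|B :&: 'C[x]%g| <= #|[set y in B :&: 'C[x]%g | good y]| + 6)%N.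
Proof.
move=> sB xSL t_neq; pose Y t := [set y in SL F :&: 'C[x]%g | trG y == t].
have cY t : (#|Y t| <= 2)%N := card_cent1_trace t two_neq0 xSL t_neq.
apply: leq_trans (leq_add (leqnn _) (leq_add (cY 0) (leq_add (cY 2) (cY (-2))))).
apply: leq_trans (leq_add (leqnn _) (leq_add (leqnn _) (leq_card_setU _ _).1)).
apply: leq_trans (leq_add (leqnn _) (leq_card_setU _ _).1).
apply: leq_trans (leq_card_setU _ _).1.
apply/subset_leq_card/subsetP=> y /[dup] yBC /setIP[yB yC].
have ySLC : y \in SL F :&: 'C[x]%g by rewrite in_setI (subsetP sB).
have yY t : trG y = t -> y \in Y t by move=> e; apply/setIdP; rewrite e.
rewrite !in_setU; have [g|] := boolP (good y).
  by apply/orP; left; apply/setIdP.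
rewrite negb_and !negbK => /orP[/eqP/yY->|/eqP e]; first by rewrite !orbT.
have : (trG y - 2) * (trG y + 2) == 0.
  by apply/eqP; apply: (eq_lin1 (k := 1) e); ring.
by rewrite mulf_eq0 subr_eq0 addr_eq0 => /orP[]/eqP/yY->; rewrite !orbT.
Qed.

(** More than 6 elements leave a good [y] in [A ^+ 2], whose centralizer lies in that of [x].
    Orbit-stabilizer for [y] uses the class in [A ^+ 4], and 17 = 4 * 4 + 1. *)
Lemma involved_card_ge A x : 1%g \in A -> (A^-1)%g = A -> <<A>>%g = SL F ->
  x \in SL F -> trG x ^+ 2 != 4 -> (6 < #|(A ^+ 2)%g :&: 'C[x]%g|)%N ->
  (#|A| ^ 3 <= 21 * #|(A ^+ 17)%g| ^ 2 * #|(A ^+ 2)%g :&: 'C[x]%g| ^ 3)%N.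
Proof.
move=> A1 AV genA xSL t_neq inv; have sASL : A \subset SL F by rewrite -genA subset_gen.
have sA2SL := expg_sub_group 2 sASL.
have [y] : exists y, y \in [set y in (A ^+ 2)%g :&: 'C[x]%g | good y].
  apply/card_gt0P; rewrite -(ltn_add2r 6) add0n.
  exact: leq_trans inv (card_cent1_good sA2SL xSL t_neq).
case/setIdP=> /setIP[yA2 yC] /andP[ty0 ty4]; have ySL := subsetP sA2SL y yA2.
have leA := card_le_class_cent1 AV yA2.
have le3 := card_class_trace 4 A1 AV genA ty0 ty4.
have leC : (#|(A ^+ 2)%g :&: 'C[y]%g| <= #|(A ^+ 2)%g :&: 'C[x]%g|)%N.
  apply/subset_leq_card/setIS/cent1_nonscalar_sub => //.
  exact: nonscalar_trace.
apply: leq_trans (_ : _ <= (_ * _) ^ 3)%N _; first by rewrite leq_exp2r; first exact: leA.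
by rewrite expnMn leq_mul // leq_exp2r.
Qed.

Lemma subset_stable_gen (gT : finGroupType) (A H : {set gT}) : 1%g \in H ->
  {in H & A, forall h a, (h * a)%g \in H} -> <<A>>%g \subset H.
Proof.
move=> H1 HA.
have gset : group_set [set b | H :* b == H]%g.
  apply/group_setP; split=> [|b c]; rewrite !inE; first by rewrite mulg1.
  by rewrite rcosetM => /eqP-> .
have sub : A \subset Group gset.
  apply/subsetP=> a aA; rewrite inE eqEcard card_rcoset leqnn andbT.
  by apply/subsetP=> _ /rcosetP[h hH ->]; exact: HA.
apply/subsetP=> g /(subsetP (etrans (gen_subG _ _) sub)); rewrite inE => /eqP <-.
by rewrite mem_rcoset mulgV.
Qed.

Section Growth.
Variables (A : {set {'GL_2[F]}}) (L : nat).
Hypotheses (A1 : 1%g \in A) (AV : (A^-1)%g = A) (genA : <<A>>%g = SL F).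
Hypotheses (leL : (#|(A ^+ 37)%g| <= L * #|A|)%N) (gtA : (21 * 6 ^ 3 * L ^ 5 < #|A|)%N).

Let leLi i : (i <= 37)%N -> (#|(A ^+ i)%g| <= L * #|A|)%N.
Proof. by move=> le; apply: leq_trans leL; apply/subset_leq_card/expg_subset. Qed.

Let A_gt0 : (0 < #|A|)%N. Proof. by apply: leq_trans gtA. Qed.

Let L_gt0 : (0 < L)%N.
Proof.
by have := leLi (isT : 1 <= 37)%N; rewrite expg1; case: L => //; rewrite mul0n leqNgt A_gt0.
Qed.

Let arith M i : (#|(A ^+ i)%g| <= L * #|A|)%N ->
  (#|A| ^ 3 <= 21 * #|(A ^+ i)%g| ^ 2 * M ^ 3)%N -> (#|A| <= 21 * L ^ 2 * M ^ 3)%N.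
Proof.
move=> lei le3; have := leq_mul lei lei; rewrite mulnn => lei2.
rewrite -(@leq_pmul2r (#|A| ^ 2)) ?expn_gt0 ?A_gt0 // -expnS.
apply: leq_trans le3 _.
apply: leq_trans (leq_mul (leq_mul (leqnn 21) lei2) (leqnn _)) _.
by rewrite -(mulnn #|A|) -(mulnn L); lia.
Qed.

(** Conjugation by [b] carries the torus elements into [A ^+ 4]. At most 6 elements of [A ^+ 2] in
    the conjugate torus would give [M <= 6 L], hence |A| <= 21 L^2 (6 L)^3, which [gtA] excludes. *)
Lemma involved_conj x b : x \in SL F -> trG x ^+ 2 != 4 -> b \in A ->
  (6 < #|(A ^+ 2)%g :&: 'C[x]%g| -> 6 < #|(A ^+ 2)%g :&: 'C[x ^ b]%g|)%N.
Proof.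
move=> xSL t_neq bA inv; have := involved_card_ge A1 AV genA xSL t_neq inv.
move/(arith (leLi (isT : 17 <= 37)%N)); set M := #|(A ^+ 2)%g :&: 'C[x]%g| => leM.
rewrite ltnNge; apply: contraL gtA => le6; rewrite -leqNgt.
have leM4 : (M <= #|(A ^+ 4)%g :&: 'C[x ^ b]%g|)%N.
  rewrite /M -(cardJg _ b); apply/subset_leq_card/subsetP=> y.
  rewrite mem_conjg => /setIP[yA2 yC].
  apply/setIP; split.
    have bVA : (b^-1)%g \in A by rewrite -AV mem_invg invgK.
    by rewrite -(conjgKV b y) conjgE expgS expgSr mem_mulg // mem_mulg.
  rewrite -(conjgKV b y); apply/cent1P; rewrite /commute -!conjMg.
  by rewrite (cent1P yC).
have := card_setI_growth 'C[x ^ b]%G 4 AV.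
move=> /(leq_trans (leq_mul leM4 (leqnn _)))/leq_trans.
move=> /(_ _ (leq_mul (leLi (isT : 5 <= 37)%N) le6)) leMA.
have {leMA}leM6 : (M <= L * 6)%N by rewrite -(leq_pmul2r A_gt0) mulnAC.
apply: leq_trans leM _; apply: leq_trans (leq_mul (leqnn _) (_ : _ <= (L * 6) ^ 3)%N) _.
  by rewrite leq_exp2r.
by rewrite expnMn -[5%N]/(2 + 3)%N expnD; lia.
Qed.

Lemma product_theorem : ((#|F| ^ 2 - 1) ^ 3 <= 21 * 28 ^ 3 * L ^ 5 * #|A| ^ 2)%N.
Proof.
have sASL : A \subset SL F by rewrite -genA subset_gen.
have [a aA7 /andP[ta0 ta4]] := good_trace two_neq0 three_neq0 A1 AV genA.
have aSL := subsetP (expg_sub_group 7 sASL) a aA7.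
pose M x := #|(A ^+ 2)%g :&: 'C[x]%g|.
have inva : (6 < M a)%N.
  have leA := card_le_class_cent1 AV aA7.
  (* Conjugates of [a] by [A] lie in [A ^+ 9], and 37 = 4 * 9 + 1. *)
  have le3 : (#|A| ^ 3 <= 21 * #|(A ^+ 37)%g| ^ 2 * M a ^ 3)%N.
    apply: leq_trans (_ : _ <= (_ * _) ^ 3)%N _; first by rewrite leq_exp2r; first exact: leA.
    by rewrite expnMn leq_mul // card_class_trace.
  have := arith leL le3; rewrite ltnNge; apply: contraL => leM.
  rewrite -ltnNge; apply: leq_ltn_trans gtA.
  have -> : (21 * 6 ^ 3 * L ^ 5 = 21 * L ^ 5 * 6 ^ 3)%N by rewrite mulnAC.
  apply: leq_mul; last by rewrite leq_exp2r.
  by rewrite leq_mul2l leq_pexp2l.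
pose H := [set g in SL F | (6 < M (a ^ g)%g)%N].
have sSLH : SL F \subset H.
  rewrite -{1}genA; apply: subset_stable_gen => [|h b].
    by rewrite inE conjg1 inva andbT; exact: (group1 (SL_group F)).
  case/setIdP=> hSL invh bA; have bSL := subsetP sASL b bA; apply/setIdP; split.
    exact: (groupM hSL bSL).
  by rewrite conjgM; apply: involved_conj; rewrite ?SL_J // trG_conj.
pose C := (a ^: SL F)%g.
have CP x : x \in C -> [/\ x \in SL F, trG x = trG a & (6 < M x)%N].
  case/imsetP=> g gSL ->; rewrite trG_conj SL_J //; split=> //.
  by have /setIdP[] := subsetP sSLH g gSL.
have aC : a \in C by rewrite class_refl.
(* The least torus count serves twice: it bounds all the others in [count], and it is itself large
   by [leM]. *)
have [x0 x0C minM] : exists2 x0, x0 \in C & {in C, forall x, (M x0 <= M x)%N}.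
  by case: (arg_minnP M aC) => x0 x0C minM; exists x0.
have leM : (#|A| <= 21 * L ^ 2 * M x0 ^ 3)%N.
  have [x0SL tx0 inv0] := CP _ x0C.
  apply: (arith (leLi (isT : 17 <= 37)%N)); apply: involved_card_ge => //.
  by rewrite tx0.
(* The centralizer of [a] has at most two elements of each trace, so at most 2 q elements. *)
have cardC : (#|F| ^ 2 - 1 <= 2 * #|C|)%N.
  have F_gt0 : (0 < #|F|)%N by apply/card_gt0P; exists 0.
  rewrite -(leq_pmul2l F_gt0); apply: leq_trans (card_GL2_SL F) _.
  have <- : (#|'C_(SL F)[a]%g| * #|C|)%N = #|SL F|.
    by rewrite -index_cent1 (Lagrange (subsetIl _ _)).
  rewrite mulnA leq_mul2r; apply/orP; right.
  rewrite -(cardsT F); apply: (leq_card_fibres (f := fun g => trG g)) => [g _|t _].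
    by rewrite inE.
  exact: (card_cent1_trace t two_neq0 aSL ta4).
(* Count commuting pairs of [x] in [C] and good [y] in [A ^+ 2]: the [x] commuting with [y] lie in
   one torus and have the trace of [a], so there are at most two. *)
have count : (#|C| * (M x0 - 6) <= #|(A ^+ 2)%g| * 2)%N.
  rewrite -sum_nat_const.
  apply: (@leq_trans (\sum_(x in C) \sum_(y in (A ^+ 2)%g) ((y \in 'C[x]%g) && good y))%N).
    apply: leq_sum => x xC; have [xSL tx _] := CP x xC; have lex := minM x xC.
    rewrite leq_subLR addnC; apply: leq_trans lex _.
    rewrite -tx in ta4.
    apply: leq_trans (card_cent1_good (expg_sub_group 2 sASL) xSL ta4) _.
    rewrite leq_add2r -card_sum_ind; apply/subset_leq_card/subsetP=> y.
    by move=> /setIdP[/setIP[yA yC] g]; apply/setIdP; rewrite yC g.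
  rewrite exchange_big -sum_nat_const; apply: leq_sum => y yA /=.
  have ySL := subsetP (expg_sub_group 2 sASL) y yA.
  have [/andP[_ ty4]|ng] := boolP (good y); last first.
    by rewrite big1 // => x _; rewrite andbF.
  apply: leq_trans (card_cent1_trace (trG a) two_neq0 ySL ty4).
  rewrite -card_sum_ind; apply/subset_leq_card/subsetP=> x /setIdP[/CP[xSL tx _]].
  rewrite andbT => yC; apply/setIdP; rewrite in_setI xSL tx eqxx; split=> //.
  by rewrite cent1C.
have [_ _ inv0] := CP x0 x0C.
exact: pivot_arith cardC count (leLi (isT : 2 <= 37)%N) inv0 leM A_gt0.
Qed.
End Growth.
End Pivot.

(** * Flattening *)

Section Flattening.
Variable F : finFieldType.
Hypotheses (two_neq0 : (2 : F) != 0) (three_neq0 : (3 : F) != 0).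

(** The popular set [D] generates a proper subgroup, or is too small for [product_theorem], or
    satisfies it. The exponents met are 2, 2 + 1 + 5 * 113 and 286, where 113 = 3 * 37 + 2; 573
    covers them all. *)
Lemma approximate_group_dichotomy (S A : {set {'GL_2[F]}}) (K M : nat) :
  S \subset SL F -> A \subset S -> A != set0 -> (0 < K)%N ->
  (8 * K <= M)%N -> (21 * 6 ^ 3 <= M)%N -> (2 ^ 3 * (21 * 28 ^ 3) <= M)%N ->
  (#|S| <= 4 * K * #|A|)%N -> (#|(A^-1 * A)%g| <= M * #|A|)%N ->
  [\/ exists (H : {group {'GL_2[F]}}) (g : {'GL_2[F]}),
        [/\ H \proper SL F, g \in SL F & (#|S| <= M ^ 573 * #|S :&: (g *: H)%g|)%N],
      (#|S| <= M ^ 573)%N | (#|F| ^ 3 <= M ^ 573 * #|S|)%N].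
Proof.
move=> sSSL sAS A_neq0 K_gt0 leKM leM1 leM2 leSA leAA.
have M_gt0 : (0 < M)%N by apply: leq_trans leKM; rewrite muln_gt0.
have M_gt1 : (1 < M)%N by apply: leq_trans leKM; clear -K_gt0; lia.
have leMX i j : (i <= j)%N -> (M ^ i <= M ^ j)%N by move=> le; rewrite leq_pexp2l.
set D := popular A M.
have sASL := subset_trans sAS sSSL.
have sDSL : D \subset SL F.
  apply: subset_trans (popular_sub M A_neq0) _.
  by rewrite mul_subG // -(invGid (SL_group F)) invSg.
have [a aA leAD] := popular_coset A_neq0 leAA.
have aSL := subsetP sASL a aA.
have leS : (#|S| <= M ^ 2 * #|A :&: (D :* a)%g|)%N.
  apply: leq_trans leSA _; rewrite -mulnn; move: leAD; rewrite -/D.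
  move: #|A :&: _| => x leAD; apply: leq_trans (leq_mul (leqnn _) leAD) _.
  by rewrite mulnA leq_mul2r; apply/orP; right; clear -leKM; nia.
have leSD : (#|S| <= M ^ 2 * #|D|)%N.
  apply: leq_trans leS _; rewrite leq_mul2l -(card_rcoset D a); apply/orP; right.
  exact/subset_leq_card/subsetIr.
have [genD|ngenD] := eqVneq <<D>>%g (SL F); last first.
  (* The right coset of [a] is the left coset by [a] of the conjugate subgroup. *)
  constructor 1; exists (<<D>> :^ a)%G, a; split=> //.
    rewrite /= -(conjGid aSL) properJ properEneq ngenD gen_subG sDSL.
    by [].
  apply: leq_trans leS _; apply: leq_mul; first exact: leMX.
  apply: subset_leq_card; apply/subsetP=> x /setIP[xA xDa].
  rewrite in_setI (subsetP sAS) //= mem_lcoset mem_conjg.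
  have -> : ((a^-1 * x) ^ a^-1 = x * a^-1)%g by rewrite conjgE -mulgA mulKg.
  by rewrite (subsetP (subset_gen _)) // -mem_rcoset.
have leM3 : (2 * M ^ 2 <= M ^ 3)%N.
  by rewrite (expnS M 2) leq_mul2r M_gt1 orbT.
have leDX m : (#|(D ^+ m)%g| <= M ^ (3 * m) * #|A|)%N.
  apply: leq_trans (card_popularX m A_neq0 leAA) _.
  by rewrite leq_mul2r expnM; case: m => [|m]; rewrite ?leqnn ?leq_exp2r ?leM3 ?orbT.
have leAM : (#|A| <= M ^ 2 * #|D|)%N.
  by apply: leq_trans leSD; apply: subset_leq_card.
have leL : (#|(D ^+ 37)%g| <= M ^ 113 * #|D|)%N.
  apply: leq_trans (leDX 37) _; rewrite -[113%N]/(3 * 37 + 2)%N (expnD M (3 * 37) 2) -mulnA.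
  by rewrite leq_mul2l leAM orbT.
have [ltD|leD] := ltnP (21 * 6 ^ 3 * (M ^ 113) ^ 5) #|D|; last first.
  constructor 2; apply: leq_trans leSD _.
  apply: leq_trans (leq_mul (leqnn _) leD) _.
  apply: (@leq_trans (M ^ 2 * (M ^ 1 * M ^ (113 * 5)))).
    rewrite leq_mul2l -expnM leq_mul2r; apply/orP; right; apply/orP; right.
    by rewrite expn1.
  by rewrite -!expnD; apply: leMX.
constructor 3.
have := product_theorem two_neq0 three_neq0 (popular1 A M_gt0) (popularV A M) genD leL ltD.
have leDS : (#|D| <= M ^ 3 * #|S|)%N.
  have := leDX 1%N; rewrite expg1 => /leq_trans; apply.
  by rewrite leq_mul2l (subset_leq_card sAS) orbT.
have q_gt1 : (1 < #|F|)%N by exact: card_finNzRing_gt1.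
have leq2 : (#|F| ^ 2 <= 2 * (#|F| ^ 2 - 1))%N.
  by clear -q_gt1; rewrite -mulnn; nia.
(* The inequality is proved squared: 2 * 286 = 1 + 5 * 113 + 2 * 3, with 1 for the numerical
   constant and 2 * 3 for the square of [leDS]. *)
move=> le; apply: (@leq_trans (M ^ 286 * #|S|)); last by rewrite leq_mul2r leMX // orbT.
rewrite -leq_sqr -expnM (expnM _ 2 3).
apply: leq_trans (_ : _ <= (2 * (#|F| ^ 2 - 1)) ^ 3)%N _; first by rewrite leq_exp2r.
rewrite expnMn; apply: leq_trans (leq_mul (leqnn _) le) _.
have leDS2 : (#|D| ^ 2 <= (M ^ 3 * #|S|) ^ 2)%N by rewrite leq_sqr.
apply: leq_trans (leq_mul (leqnn _) (leq_mul (leqnn _) leDS2)) _.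
rewrite (expnMn (M ^ 3)) (expnMn (M ^ 286)) -!(expnM M).
apply: (@leq_trans (M ^ 1 * M ^ (113 * 5) * (M ^ (3 * 2) * #|S| ^ 2))).
  rewrite (mulnA (2 ^ 3)%N) (mulnA (2 ^ 3)%N) leq_mul2r; apply/orP; right.
  by rewrite leq_mul2r expn1 leM2 orbT.
by rewrite (mulnA _ (M ^ (3 * 2))%N) -!expnD leq_mul2r leMX ?orbT.
Qed.

(** The constant of [M] is a sum so that it dominates each threshold of
    [approximate_group_dichotomy] at once. *)
Lemma energy_flattening (S : {set {'GL_2[F]}}) (K : nat) :
  let M := ((24 * 512 ^ 2 + (21 * 6 ^ 3 + 2 ^ 3 * (21 * 28 ^ 3))) * K ^ 10)%N in
  S \subset SL F -> S != set0 -> (#|S| ^ 3 <= K * energy S)%N ->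
  [\/ exists (H : {group {'GL_2[F]}}) (g : {'GL_2[F]}),
        [/\ H \proper SL F, g \in SL F & (#|S| <= M ^ 573 * #|S :&: (g *: H)%g|)%N],
      (#|S| <= M ^ 573)%N | (#|F| ^ 3 <= M ^ 573 * #|S|)%N].
Proof.
move=> M sSSL; rewrite -card_gt0 => S_gt0 leE.
have K_gt0 : (0 < K)%N.
  rewrite lt0n; apply: contraTneq leE => ->.
  by rewrite mul0n -ltnNge expn_gt0 S_gt0.
have [A [sAS leSA leAA]] := bsg_nonempty leE S_gt0.
have A_neq0 : A != set0.
  by apply: contraTneq leSA => ->; rewrite cards0 muln0 -ltnNge.
have K10 : (0 < K ^ 10)%N by rewrite expn_gt0 K_gt0.
have leM0 : (24 * 512 ^ 2 * K ^ 10 <= M)%N by rewrite leq_mul2r leq_addr orbT.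
have leM1 : (21 * 6 ^ 3 <= M)%N.
  by apply: leq_trans (leq_pmulr _ K10); rewrite addnCA leq_addr.
have leM2 : (2 ^ 3 * (21 * 28 ^ 3) <= M)%N.
  by apply: leq_trans (leq_pmulr _ K10); rewrite addnA leq_addl.
have leM3 : (8 * K <= M)%N.
  apply: leq_trans leM0; apply: leq_mul; last by rewrite -{1}(expn1 K) leq_pexp2l.
  have c_gt0 : (0 < 512 ^ 2)%N by rewrite expn_gt0.
  exact: (@leq_trans 24 8 _ isT (leq_pmulr 24 c_gt0)).
have leAM : (#|(A^-1 * A)%g| <= M * #|A|)%N.
  by apply: leq_trans leAA _; rewrite leq_mul2r leM0 orbT.
clearbody M; exact: (approximate_group_dichotomy sSSL sAS A_neq0 K_gt0 leM3 leM1 leM2 leSA leAM).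
Qed.
End Flattening.

(** * Incidences and energy *)

Section Action.
Variable F : finFieldType.
Implicit Types (g : {'GL_2[F]}) (u v w y z : 'cV[F]_2) (A B : {set 'cV[F]_2}).

Lemma cross_complement y : y != 0 -> exists z, cross y z = 1.
Proof.
case/colvec2_neq0=> nz.
  exists (\col_i if i == 0 then 0 else (y 0 0)^-1); rewrite /cross !mxE /=.
  by rewrite mulr0 subr0 mulfV.
exists (\col_i if i == 0 then - (y 1 0)^-1 else 0); rewrite /cross !mxE /=.
by rewrite mulr0 sub0r mulrN opprK mulfV.
Qed.

Lemma card_cross_fibre y : y != 0 -> #|[set w | cross y w == 1]| = #|F|.
Proof.
move=> y_neq0; have [z ez] := cross_complement y_neq0.
have inj : injective (fun s : F => z + s *: y).
  move=> s t /addrI /eqP; rewrite -subr_eq0 -scalerBl scaler_eq0.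
  by rewrite (negPf y_neq0) orbF subr_eq0 => /eqP.
rewrite -cardsT -(card_imset _ inj); apply: eq_card => w; rewrite inE.
apply/eqP/imsetP=> [ew|[s _ ->]]; last first.
  by rewrite -ez /cross !mxE; ring.
have [s es] : exists s, w - z = s *: y.
  by apply: cross_eq0 => //; apply: (eq_lin2 (k1 := 1) (k2 := -1) ew ez); rewrite /cross !mxE; ring.
by exists s; rewrite ?inE // -es addrC subrK.
Qed.

(** Complete [y] by [z] to determinant 1. Then [g] is determined by the image of [z], which runs
    over the affine line of [w] with [cross y' w = 1]. *)
Lemma card_transporter y y' : y != 0 -> y' != 0 ->
  #|[set g in SL F | GLval g *m y == y']| = #|F|.
Proof.
move=> y_neq0 y'_neq0; have [z ez] := cross_complement y_neq0.
have yz_neq0 : cross y z != 0 by rewrite ez oner_eq0.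
rewrite -(card_cross_fibre y'_neq0).
have inj : {in [set g in SL F | GLval g *m y == y'] &, injective (fun g => GLval g *m z)}.
  move=> g h /setIdP[_ /eqP eg] /setIdP[_ /eqP eh] e; apply: GLval_inj.
  by apply: (mul_cross_inj yz_neq0); rewrite ?eg ?eh.
rewrite -(card_in_imset inj); apply: eq_card => w; rewrite inE.
apply/imsetP/eqP=> [[g /setIdP[/SL_det dg /eqP <-] ->]|ew].
  by rewrite cross_mul dg ez mulr1.
(* This is the map sending v to [cross v z] times [y'] plus [cross y v] times [w]. *)
pose M : 'M[F]_2 := \matrix_(i, j) (y' i 0 * (if j == 0 then z 1 0 else - z 0 0)
                                   + w i 0 * (if j == 0 then - y 1 0 else y 0 0)).
rewrite /cross in ez ew.
have My : M *m y = y'.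
  apply: colvec2P; rewrite !mulmx2E !mxE /=.
    by apply: (eq_lin1 (k := y' 0 0) ez); ring.
  by apply: (eq_lin1 (k := y' 1 0) ez); ring.
have Mz : M *m z = w.
  apply: colvec2P; rewrite !mulmx2E !mxE /=.
    by apply: (eq_lin1 (k := w 0 0) ez); ring.
  by apply: (eq_lin1 (k := w 1 0) ez); ring.
have [g gSL eg] : exists2 g, g \in SL F & GLval g = M.
  apply: SL_of_matrix; rewrite det2E !mxE /=.
  by apply: (eq_lin2 (k1 := y' 0 0 * w 1 0 - y' 1 0 * w 0 0) (k2 := 1) ez ew); ring.
by exists g; rewrite ?inE ?eg ?Mz // -[\det M == 1]/(\det M == 1) -eg SL_det // eg My !eqxx.
Qed.

Lemma card_colvec2 : #|{: 'cV[F]_2}| = (#|F| ^ 2)%N.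
Proof. by rewrite card_mx. Qed.

Lemma card_SL_le : (#|SL F| <= (#|F| ^ 2 - 1) * #|F|)%N.
Proof.
have e_neq0 : (delta_mx 0 0 : 'cV[F]_2) != 0.
  by apply/eqP=> /matrixP/(_ 0 0)/eqP; rewrite !mxE oner_eq0.
rewrite -card_colvec2 subn1 -(cardsC1 (0 : 'cV[F]_2)).
apply: (leq_card_fibres (f := fun g => GLval g *m delta_mx 0 0)) => [g _|y].
  by rewrite !inE GLmul_eq0.
by rewrite !inE => y_neq0; rewrite card_transporter.
Qed.

Definition hits B g := #|[set y in B | GLval g *m y \in B]|.

Lemma mem_sum_eq (T : finType) (B : {set T}) (x : T) : (x \in B : nat) = (\sum_(y in B) (x == y))%N.
Proof.
have [xB|xB] := boolP (x \in B).
  by rewrite (bigD1 x) //= eqxx big1 // => y /andP[_ /negPf]; rewrite eq_sym => ->.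
by rewrite big1 // => y yB; apply/eqP; rewrite eqb0; apply: contraNneq xB => ->.
Qed.

Lemma card_hit B y : y != 0 -> 0 \notin B ->
  (\sum_(g in SL F) (GLval g *m y \in B) = #|B| * #|F|)%N.
Proof.
move=> y_neq0 B0; under eq_bigr do rewrite mem_sum_eq.
rewrite exchange_big -sum_nat_const; apply: eq_bigr => y' y'B /=.
rewrite -card_sum_ind card_transporter //.
by apply: contraNneq B0 => <-.
Qed.

Lemma sum_hits B : 0 \notin B -> (\sum_(g in SL F) hits B g = #|B| ^ 2 * #|F|)%N.
Proof.
move=> B0; rewrite /hits; under eq_bigr do rewrite card_sum_ind.
rewrite exchange_big /= (eq_bigr (fun=> #|B| * #|F|)%N).
  by rewrite sum_nat_const mulnA.
by move=> y yB; apply: card_hit => //; apply: contraNneq B0 => <-.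
Qed.

Definition cross_count B (t : F) := (\sum_(y in B) \sum_(z in B) (cross y z == t))%N.

(** If [cross y z] is nonzero, [g] is determined by the images of [y] and [z], a pair of [B] with
    the same determinant. For each [y] there are at most [k] dependent [z], and there the condition
    on [z] is dropped. *)
Lemma sum_hits_sqr B k : 0 \notin B ->
  {in B, forall y, (#|[set z in B | (cross y z == 0)%R]| <= k)%N} ->
  (\sum_(g in SL F) hits B g ^ 2 <=
   k * #|F| * #|B| ^ 2 + \sum_t cross_count B t ^ 2)%N.
Proof.
move=> B0 lek.
have -> : (\sum_(g in SL F) hits B g ^ 2 = \sum_(y in B) \sum_(z in B)
    \sum_(g in SL F) ((GLval g *m y \in B) * (GLval g *m z \in B)))%N.
  rewrite (eq_bigr (fun g => \sum_(y in B) \sum_(z in B)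
      ((GLval g *m y \in B) * (GLval g *m z \in B)))%N).
    by rewrite exchange_big; apply: eq_bigr => y _; rewrite exchange_big.
  by move=> g _; rewrite /hits card_sum_ind -mulnn big_distrlr.
have -> : (\sum_t cross_count B t ^ 2 = \sum_(y in B) \sum_(z in B) cross_count B (cross y z))%N.
  rewrite (eq_bigr (fun t => \sum_(y in B) \sum_(z in B) (cross y z == t) * cross_count B t)%N).
    rewrite exchange_big; apply: eq_bigr => y _; rewrite exchange_big; apply: eq_bigr => z _.
    rewrite (bigD1 (cross y z)) //= eqxx mul1n big1 ?addn0 // => t /negPf.
    by rewrite eq_sym => ->.
  move=> t _; rewrite -mulnn {1}/cross_count big_distrl; apply: eq_bigr => y _.
  by rewrite big_distrl.
apply: (@leq_trans (\sum_(y in B) \sum_(z in B)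
   ((cross y z == 0%R) * (#|B| * #|F|) + cross_count B (cross y z)))%N); last first.
  rewrite (eq_bigr (fun y => \sum_(z in B) (cross y z == 0%R) * (#|B| * #|F|) +
     \sum_(z in B) cross_count B (cross y z))%N); last by move=> y _; rewrite big_split.
  rewrite big_split leq_add2r /= -mulnn.
  rewrite (_ : k * #|F| * (#|B| * #|B|) = #|B| * (k * (#|B| * #|F|)))%N; last lia.
  rewrite -sum_nat_const; apply: leq_sum => y yB.
  by rewrite -big_distrl leq_mul2r -card_sum_ind lek ?orbT.
apply: leq_sum => y yB; apply: leq_sum => z zB.
have [_|nz] := eqVneq (cross y z) 0.
  rewrite mul1n; apply: leq_trans (leq_addr _ _).
  rewrite -(card_hit (y := y)) //; last by apply: contraNneq B0 => <-.
  by apply: leq_sum => g _; case: (_ \in B) => //; rewrite ?mul1n ?leq_b1.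
rewrite mul0n add0n /cross_count.
rewrite (eq_bigr (fun g => ((GLval g *m y \in B) && (GLval g *m z \in B) : nat))%N); last first.
  by move=> g _; rewrite mulnb.
rewrite -card_sum_ind.
rewrite (_ : (\sum_(y' in B) \sum_(z' in B) (cross y' z' == cross y z))%N =
   #|[set p in setX B B | cross p.1 p.2 == cross y z]|); last first.
  rewrite card_sum_ind (eq_bigl (fun p => (p.1 \in B) && (p.2 \in B))).
    by rewrite -(pair_big_dep (mem B) (fun=> mem B) (fun a b => cross a b == cross y z : nat)).
  by move=> [a b]; rewrite inE.
apply: (leq_card_in_inj (f := fun g => (GLval g *m y, GLval g *m z))).
  move=> g /setIdP[/SL_det dg /andP[gy gz]]; apply/setIdP; split; first exact/setXP.
  by rewrite /= cross_mul dg mul1r.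
move=> g h _ _ [ey ez]; apply: GLval_inj; exact: mul_cross_inj nz ey ez.
Qed.
End Action.

(** * Distribution of determinants on [B] and the variance of [hits] *)

Section CrossEnergy.
Variables (F : finFieldType) (B : {set 'cV[F]_2}) (k : nat).
Hypothesis B0 : 0 \notin B.
Hypothesis lek : {in [set~ 0], forall y, (#|[set z in B | (cross y z == 0)%R]| <= k)%N}.
Implicit Types (u v w y z : 'cV[F]_2) (t s : F).

Let slice y t := (\sum_(z in B) (cross y z == t))%N.
Let W y := (\sum_t slice y t ^ 2)%N.

Let sum_slice y : (\sum_t slice y t = #|B|)%N.
Proof.
rewrite /slice exchange_big -sum1_card; apply: eq_bigr => z _.
by rewrite (bigD1 (cross y z)) //= eqxx big1 // => t /negPf; rewrite eq_sym => ->.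
Qed.

Let W_pairs y : (W y = \sum_(z in B) \sum_(w in B) (cross y z == cross y w))%N.
Proof.
rewrite /W (eq_bigr (fun t => \sum_(z in B) \sum_(w in B)
    (cross y z == t) * (cross y w == t))%N); last first.
  by move=> t _; rewrite -mulnn big_distrlr.
rewrite exchange_big; apply: eq_bigr => z _; rewrite exchange_big; apply: eq_bigr => w _ /=.
rewrite (bigD1 (cross y z)) //= eqxx mul1n big1 ?addn0 1?eq_sym // => t /negPf.
by rewrite eq_sym => ->.
Qed.

Let W_scale s y : s != 0 -> W (s *: y) = W y.
Proof.
move=> s_neq0; rewrite !W_pairs; apply: eq_bigr => z _; apply: eq_bigr => w _.
have crossZl x : cross (s *: y) x = s * cross y x by rewrite /cross !mxE; ring.
by rewrite !crossZl (inj_eq (mulfI s_neq0)).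
Qed.

Let card_line_le w : w != 0 -> (\sum_(u | u != 0%R) (cross u w == 0%R) <= #|F| - 1)%N.
Proof.
move=> w_neq0; rewrite subn1 -(cardsC1 (0 : F)).
rewrite (eq_bigl [in [set~ 0]]); last by move=> u; rewrite !inE.
rewrite -card_sum_ind.
have sub : [set u in [set~ 0] | cross u w == 0] \subset [set c *: w | c in [set~ 0]].
  apply/subsetP=> u /setIdP[]; rewrite !inE => u_neq0 /eqP e.
  have [c ec] : exists c, u = c *: w.
    by apply: cross_eq0 => //; apply: (eq_lin1 (k := -1) e); rewrite /cross; ring.
  apply/imsetP; exists c => //; rewrite !inE.
  by apply: contraNneq u_neq0 => c0; rewrite ec c0 scale0r.
exact: leq_trans (subset_leq_card sub) (leq_imset_card _ _).
Qed.

(** Pairs with z = w count for every nonzero [u]; a pair with z != w only for the q - 1 nonzero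
    multiples of [z - w]. *)
Let sum_W_le : (\sum_(u | u != 0%R) W u <= #|B| * (#|F| ^ 2 - 1) + #|B| ^ 2 * (#|F| - 1))%N.
Proof.
rewrite (eq_bigr (fun u => \sum_(z in B) \sum_(w in B) (cross u z == cross u w))%N); last first.
  by move=> u _; rewrite W_pairs.
rewrite exchange_big /=.
apply: (@leq_trans (\sum_(z in B) ((#|F| ^ 2 - 1) + #|B| * (#|F| - 1)))%N); last first.
  by rewrite sum_nat_const mulnDr mulnA mulnn.
apply: leq_sum => z zB; rewrite exchange_big (bigD1 z) //=.
apply: leq_add.
  rewrite (eq_bigr (fun=> 1%N)); last by move=> u _; rewrite eqxx.
  rewrite sum1_card -card_colvec2 subn1 -(cardsC1 (0 : 'cV[F]_2)) eq_leq //.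
  by apply: eq_card => u; rewrite !inE.
rewrite -sum_nat_const big_mkcond [leqRHS]big_mkcond /=; apply: leq_sum => w _.
have [wB|//] := boolP (w \in B); have [//|nwz /=] := eqVneq w z.
have nzw : z - w != 0 by rewrite subr_eq0 eq_sym.
apply: leq_trans (card_line_le nzw); apply: leq_sum => u _.
have -> : cross u (z - w) = cross u z - cross u w by rewrite /cross !mxE; ring.
by rewrite subr_eq0.
Qed.

Variable R : realFieldType.

Let b : R := #|B|%:R.
Let q : R := #|F|%:R.

Let q_gt1 : 1 < q.
Proof. by rewrite /q ltr1n card_finNzRing_gt1. Qed.

Let q_gt0 : 0 < q. Proof. exact: lt_trans ltr01 q_gt1. Qed.

(** The deviation of [B] from equidistribution among the q lines parallel to [y], by [omE]. *)
Let om y : R := (W y)%:R - b ^+ 2 / q.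

Let dev_sum (f : F -> nat) (n : nat) : (\sum_t f t = n)%N ->
  \sum_t ((f t)%:R - n%:R / q) ^+ 2 = (\sum_t f t ^ 2)%N%:R - n%:R ^+ 2 / q :> R.
Proof.
move=> sf.
rewrite (eq_bigr (fun t => (f t ^ 2)%N%:R - (2 * (n%:R / q) * (f t)%:R) + (n%:R / q) ^+ 2)).
  rewrite big_split sumrB /= -mulr_sumr -!natr_sum sf sumr_const -mulr_natr -/q.
  by field; rewrite gt_eqF.
by move=> t _; rewrite natrX; ring.
Qed.

Let omE y : om y = \sum_t ((slice y t)%:R - b / q) ^+ 2.
Proof. by rewrite /om dev_sum. Qed.

Let om_ge0 y : 0 <= om y.
Proof. by rewrite omE sumr_ge0 // => t _; exact: sqr_ge0. Qed.

Let om_scale s y : s != 0 -> om (s *: y) = om y.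
Proof. by move=> s_neq0; rewrite /om W_scale. Qed.

Let scale_indicator y u : y != 0 ->
  (\sum_(s : F | s != 0%R) (u == s *: y) <= (cross u y == 0%R))%N.
Proof.
move=> y_neq0; rewrite (eq_bigl [in [set~ 0]]); last by move=> s; rewrite !inE.
rewrite -card_sum_ind; set X := [set s in _ | _].
have [->|[s sX]] := set_0Vmem X; first by rewrite cards0.
have /setIdP[_ /eqP e] := sX.
have -> : cross u y == 0 by rewrite e /cross !mxE; apply/eqP; ring.
rewrite -[nat_of_bool true](cards1 s); apply/subset_leq_card/subsetP=> t /setIdP[_ /eqP].
rewrite e inE => /eqP; rewrite -subr_eq0 -scalerBl scaler_eq0 (negPf y_neq0) orbF.
by rewrite subr_eq0 eq_sym.
Qed.

(* [om] is constant on punctured lines, so averaging over scalings turns the sum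
   over [B], which meets each line at most [k] times, into a sum over all vectors. *)
Let sum_om_le : (q - 1) * \sum_(y in B) om y <= k%:R * \sum_(u | u != 0) om u.
Proof.
have -> : (q - 1) * \sum_(y in B) om y =
    \sum_(u | u != 0) om u * (\sum_(y in B) \sum_(s : F | s != 0%R) (u == s *: y))%N%:R.
  rewrite [RHS](eq_bigr (fun u =>
      \sum_(y in B) \sum_(s : F | s != 0) om u * (u == s *: y)%:R)); last first.
    move=> u _; rewrite natr_sum mulr_sumr; apply: eq_bigr => y _.
    by rewrite natr_sum mulr_sumr.
  rewrite [LHS]mulr_sumr [RHS]exchange_big; apply: eq_bigr => y yB /=.
  have y_neq0 : y != 0 by apply: contraNneq B0 => <-.
  rewrite [RHS]exchange_big /= [RHS](eq_bigr (fun=> om y)); last first.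
    move=> s s_neq0; rewrite (bigD1 (s *: y)) ?scaler_eq0 ?negb_or ?s_neq0 //=.
    rewrite eqxx mulr1 om_scale // big1 ?addr0 // => u /andP[_ /negPf->].
    by rewrite mulr0.
  rewrite sumr_const -mulr_natr mulrC; congr (_ * _).
  rewrite (_ : #|_| = #|F|.-1); last first.
    by rewrite -(cardsC1 (0 : F)); apply: eq_card => s; rewrite !inE.
  by rewrite -subn1 natrB // ltnW // card_finNzRing_gt1.
rewrite mulr_sumr; apply: ler_sum => u u_neq0; rewrite mulrC ler_wpM2r //.
have uP : u \in [set~ 0] by rewrite !inE.
rewrite ler_nat; apply: leq_trans (lek uP).
rewrite card_sum_ind; apply: leq_sum => y yB.
have y_neq0 : y != 0 by apply: contraNneq B0 => <-.
exact: scale_indicator.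
Qed.

(** [cross_count] is a sum of slices over [y] in [B], so by Cauchy-Schwarz its variance is at most b
    times the sum of [om] over [B]. Over all nonzero vectors [om] sums to at most b (q^2 - 1), and
    [sum_om_le] turns this into k b (q + 1). *)
Lemma cross_energy_le :
  (\sum_t cross_count B t ^ 2)%N%:R <= b ^+ 4 / q + k%:R * (q + 1) * b ^+ 2.
Proof.
have scount : (\sum_t cross_count B t = #|B| ^ 2)%N.
  rewrite /cross_count exchange_big /= (eq_bigr (fun=> #|B|)) ?sum_nat_const ?mulnn //.
  by move=> y _; rewrite sum_slice.
have dev := dev_sum scount.
have CS : \sum_t ((cross_count B t)%:R - (#|B| ^ 2)%N%:R / q) ^+ 2 <= b * \sum_(y in B) om y.
  under [X in _ <= _ * X]eq_bigr do rewrite omE.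
  rewrite exchange_big mulr_sumr; apply: ler_sum => t _ /=.
  have -> : (cross_count B t)%:R - (#|B| ^ 2)%N%:R / q =
      \sum_(y in B) 1 * ((slice y t)%:R - b / q) :> R.
    under eq_bigr do rewrite mul1r.
    rewrite sumrB sumr_const natr_sum natrX -/b -mulr_natr -/b; congr (_ - _).
    by ring.
  apply: le_trans (Cauchy_Schwarz_sum _ _ _) _.
  by under [X in X * _ <= _]eq_bigr do rewrite expr1n; rewrite sumr_const.
have le_om : \sum_(u | u != 0) om u <= b * (q ^+ 2 - 1).
  rewrite /om sumrB sumr_const -natr_sum.
  have : ((\sum_(u | u != 0%R) W u)%N%:R : R) <= b * (q ^+ 2 - 1) + b ^+ 2 * (q - 1).
    have F_gt0 : (0 < #|F|)%N by apply: ltnW; exact: card_finNzRing_gt1.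
    move: sum_W_le; rewrite -(ler_nat R) natrD !natrM !natrB ?expn_gt0 ?F_gt0 //.
    by rewrite !natrX.
  rewrite (_ : #|_| = (#|F| ^ 2).-1); last first.
    rewrite -card_colvec2 -(cardsC1 (0 : 'cV[F]_2)).
    by apply: eq_card => s; rewrite !inE.
  have -> : (b ^+ 2 / q) *+ (#|F| ^ 2).-1 = b ^+ 2 * (q - 1) + b ^+ 2 * (q - 1) / q.
    rewrite -mulr_natr -subn1 natrB ?expn_gt0; last by rewrite ltnW // card_finNzRing_gt1.
    by rewrite natrX -/q; field; rewrite gt_eqF.
  have : 0 <= b ^+ 2 * (q - 1) / q.
    by rewrite divr_ge0 ?mulr_ge0 ?sqr_ge0 ?subr_ge0 // ltW.
  by lra.
have q1 : 0 < q - 1 by rewrite subr_gt0.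
have sum_le : \sum_(y in B) om y <= k%:R * (b * (q + 1)).
  rewrite -(ler_pM2l q1); apply: le_trans sum_om_le _.
  rewrite (_ : (q - 1) * _ = k%:R * (b * (q ^+ 2 - 1))); last by ring.
  by rewrite ler_wpM2l.
have b_ge0 : 0 <= b by [].
have := le_trans CS (ler_wpM2l b_ge0 sum_le).
rewrite dev natrX -/b -exprM.
have -> : b * (k%:R * (b * (q + 1))) = k%:R * (q + 1) * b ^+ 2 by ring.
by rewrite lerBlDl.
Qed.

(** The terms in b^4 combine to a nonpositive quantity. The rest is k q b^2 from dependent pairs and
    k (q + 1) b^2 from [cross_energy_le], together at most 3 k q b^2. *)
Lemma variance_hits : \sum_(g in SL F) ((hits B g)%:R - b ^+ 2 / (q ^+ 2 - 1)) ^+ 2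
   <= 3 * k%:R * q * b ^+ 2.
Proof.
set m := b ^+ 2 / (q ^+ 2 - 1).
have q21 : 0 < q ^+ 2 - 1.
  by rewrite subr_gt0 expr2; apply: lt_trans q_gt1 _; rewrite ltr_pMr.
rewrite (eq_bigr (fun g => (hits B g ^ 2)%N%:R - (2 * m * (hits B g)%:R) + m ^+ 2)); last first.
  by move=> g _; rewrite natrX; ring.
rewrite big_split sumrB /= -mulr_sumr -!natr_sum sum_hits // sumr_const.
have lek' : {in B, forall y, (#|[set z in B | (cross y z == 0)%R]| <= k)%N}.
  by move=> y yB; apply: lek; rewrite !inE; apply: contraNneq B0 => <-.
have := sum_hits_sqr B0 lek'; rewrite -(ler_nat R) natrD natrM natrX natrM -/b -/q => le2.
have leS : m ^+ 2 *+ #|SL F| <= m ^+ 2 * ((q ^+ 2 - 1) * q).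
  rewrite -mulr_natr ler_wpM2l ?sqr_ge0 //.
  have := card_SL_le F; rewrite -(ler_nat R) natrM natrB ?natrX //.
  by rewrite expn_gt0 ltnW // card_finNzRing_gt1.
have le5 := cross_energy_le.
rewrite natrM natrX -/b -/q.
have eS : m ^+ 2 * ((q ^+ 2 - 1) * q) = q * b ^+ 4 / (q ^+ 2 - 1).
  by rewrite /m; field; rewrite gt_eqF.
have em : 2 * m * (b ^+ 2 * q) = 2 * (q * b ^+ 4 / (q ^+ 2 - 1)).
  by rewrite /m; field; rewrite gt_eqF.
have leq : b ^+ 4 / q <= q * b ^+ 4 / (q ^+ 2 - 1).
  rewrite ler_pdivrMr // mulrAC ler_pdivlMr // mulrC.
  have : 0 <= b ^+ 4 by rewrite exprn_ge0 // ler0n.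
  nra.
have kb : k%:R * b ^+ 2 <= k%:R * q * b ^+ 2.
  by rewrite ler_wpM2r ?sqr_ge0 // ler_peMr // ltW.
have -> : 3 * k%:R * q * b ^+ 2 = 3 * (k%:R * q * b ^+ 2) by ring.
have e6 : k%:R * (q + 1) * b ^+ 2 = k%:R * q * b ^+ 2 + k%:R * b ^+ 2 by ring.
by lra.
Qed.
End CrossEnergy.

Section Incidences.
Variable F : finFieldType.
Implicit Types (A B : {set 'cV[F]_2}) (S : {set {'GL_2[F]}}).

Definition incidence_count A B S :=
  #|[set q in setX (setX A B) S | GLval q.2 *m q.1.2 == q.1.1]|.

Lemma reps_notin_SL S g : S \subset SL F -> g \notin SL F -> reps S g = 0%N.
Proof.
move=> sS gSL; apply/eqP; rewrite cards_eq0; apply/eqP/setP=> a.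
rewrite in_set0; apply: contraNF gSL => /setIdP[aS agS].
rewrite -(mulKg a g); apply: (@groupM _ (SL_group F)); last exact: subsetP agS.
by rewrite groupV; exact: (subsetP sS).
Qed.

Lemma incidence_sqr_le A B S : S \subset SL F ->
  (incidence_count A B S ^ 2 <= #|A| * \sum_(g in SL F) reps S g * hits B g)%N.
Proof.
move=> sS.
pose c (x : 'cV[F]_2) := (\sum_(a in S) ((GLval a^-1)%g *m x \in B))%N.
have le1 : (incidence_count A B S <= \sum_(x in A) c x)%N.
  have -> : (\sum_(x in A) c x = #|[set p in setX A S | GLval p.2^-1%g *m p.1 \in B]|)%N.
    rewrite card_sum_ind (eq_bigl (fun p => (p.1 \in A) && (p.2 \in S))).
      by rewrite -(pair_big_dep (mem A) (fun=> mem S) (fun x a => GLval a^-1%g *m x \in B : nat)).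
    by move=> [x a]; rewrite inE.
  apply: (leq_card_in_inj (f := fun q => (q.1.1, q.2))) => [[[x y] a]|].
    case/setIdP=> /setXP[/setXP[xA yB] aS] /eqP /= e; apply/setIdP; split; first exact/setXP.
    by rewrite /= -e mulmxA GLmulVx mul1mx.
  move=> [[x y] a] [[x' y'] a'] /setIdP[_ /eqP /= e] /setIdP[_ /eqP /= e'] [ex ea].
  rewrite -ex -ea in e' *; congr (_, _, _).
  by rewrite -[y]mul1mx -(GLmulVx a) -mulmxA e -e' mulmxA GLmulVx mul1mx.
apply: leq_trans (_ : _ <= (\sum_(x in A) c x) ^ 2)%N _; first by rewrite leq_sqr.
apply: leq_trans (sqr_sum_nat _ _) _; rewrite leq_mul2l; apply/orP; right.
(* Extending the sum to the whole plane allows the substitution of [a y] for [x], after which only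
   the quotient of [a] and [b] matters. *)
apply: (@leq_trans (\sum_x c x ^ 2)%N).
  by rewrite big_mkcond; apply: leq_sum => x _; case: ifP.
rewrite (_ : (\sum_(g in SL F) reps S g * hits B g = \sum_g reps S g * hits B g)%N); last first.
  rewrite [RHS](bigID [in SL F]) /= [X in (_ + X)%N]big1 ?addn0 // => g gSL.
  by rewrite reps_notin_SL.
rewrite sum_reps_mul (eq_bigr (fun x => \sum_(a in S) \sum_(b in S)
    ((GLval a^-1)%g *m x \in B) * ((GLval b^-1)%g *m x \in B))%N); last first.
  by move=> x _; rewrite -mulnn big_distrlr.
rewrite exchange_big [leqRHS]exchange_big eq_leq //; apply: eq_bigr => a _ /=.
rewrite exchange_big; apply: eq_bigr => b _ /=.
have inj : injective (@mulmx F 2 2 1 (GLval a)).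
  by move=> y z e; rewrite -[y]mul1mx -(GLmulVx a) -mulmxA e mulmxA GLmulVx mul1mx.
rewrite (reindex_inj inj) /hits card_sum_ind [RHS]big_mkcond; apply: eq_bigr => y _.
rewrite mulmxA GLmulVx mul1mx GL_MxE -mulmxA.
by case: (y \in B); rewrite ?mul1n ?mul0n.
Qed.

Lemma sum_reps_SL S (R : pzSemiRingType) : S \subset SL F ->
  \sum_(g in SL F) (reps S g)%:R = (#|S| ^ 2)%N%:R :> R.
Proof.
move=> sS; rewrite -natr_sum -sum_reps_all [in RHS](bigID [in SL F]) /=.
by rewrite [X in (_ + X)%N]big1 ?addn0 // => g gSL; exact: reps_notin_SL.
Qed.

Lemma incidence_bound (R : rcfType) A B S k : S \subset SL F -> 0 \notin B ->
  {in [set~ 0], forall y, (#|[set z in B | (cross y z == 0)%R]| <= k)%N} ->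
  (incidence_count A B S)%:R ^+ 2 <= #|A|%:R *
    (#|S|%:R ^+ 2 * (#|B|%:R ^+ 2 / (#|F|%:R ^+ 2 - 1))
     + Num.sqrt (3 * k%:R * #|F|%:R * #|B|%:R ^+ 2 * (energy S)%:R)) :> R.
Proof.
move=> sS B0 lek; have := incidence_sqr_le A B sS.
rewrite -(ler_nat R) natrX natrM => /le_trans; apply; rewrite ler_wpM2l // natr_sum.
set m : R := #|B|%:R ^+ 2 / _; set V : R := 3 * _ * _ * _.
have leV : \sum_(g in SL F) ((hits B g)%:R - m) ^+ 2 <= V := variance_hits B0 lek R.
rewrite (eq_bigr (fun g => (reps S g)%:R * m + (reps S g)%:R * ((hits B g)%:R - m))); last first.
  by move=> g _; rewrite natrM; ring.
rewrite big_split /= -mulr_suml sum_reps_SL // natrX lerD2l.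
apply: le_trans (ler_norm _) _; rewrite -sqrtr_sqr; apply: ler_wsqrtr.
apply: le_trans (Cauchy_Schwarz_sum _ _ _) _; rewrite [leRHS]mulrC.
apply: ler_pM => //; try by apply: sumr_ge0 => g _; exact: sqr_ge0.
rewrite /energy natr_sum [leRHS](bigID [in SL F]) /=.
under eq_bigr do rewrite -natrX.
by rewrite lerDl sumr_ge0.
Qed.
End Incidences.

(** * The incidence bound *)

Lemma energy_flattening_poly : exists c e : nat,
  forall (F : finFieldType) (S : {set {'GL_2[F]}}) (K : nat),
  (2 : F) != 0 -> (3 : F) != 0 -> S \subset SL F -> S != set0 ->
  (#|S| ^ 3 <= K * energy S)%N ->
  [\/ exists (H : {group {'GL_2[F]}}) (g : {'GL_2[F]}),
        [/\ H \proper SL F, g \in SL F & (#|S| <= c * K ^ e * #|S :&: (g *: H)%g|)%N],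
      (#|S| <= c * K ^ e)%N | (#|F| ^ 3 <= c * K ^ e * #|S|)%N].
Proof.
exists ((24 * 512 ^ 2 + (21 * 6 ^ 3 + 2 ^ 3 * (21 * 28 ^ 3))) ^ 573)%N, (10 * 573)%N.
move=> F S K two three sS S0 leE.
by have := energy_flattening two three sS S0 leE; rewrite /= (expnMn _ (K ^ 10)) -(expnM K).
Qed.

Lemma Fp_neq0 p n : prime p -> (0 < n < p)%N -> (n%:R : 'F_p) != 0.
Proof.
move=> p_pr /andP[n_gt0 ltnp].
have pcharp : p \in [pchar 'F_p] by rewrite pchar_Fp.
by rewrite -(dvdn_pcharf pcharp) gtnNdvd.
Qed.

Section Final.
Variable R : realType.
Implicit Types (x r : R).

Lemma powRX_nat x r n : (x `^ r) ^+ n = x `^ (r * n%:R).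
Proof. by rewrite powRrM powR_mulrn // powR_ge0. Qed.

Lemma powR_root x n : 0 <= x -> (0 < n)%N -> (x `^ (1 / n%:R)) ^+ n = x.
Proof.
move=> x_ge0 n_gt0; rewrite powRX_nat div1r mulVf ?powRr1 //.
by rewrite pnatr_eq0 -lt0n.
Qed.

Lemma ex_nat_powR (C r : R) : 0 < r -> exists n0, forall n, (n0 <= n)%N -> C <= n%:R `^ r.
Proof.
move=> r_gt0; exists (Num.bound (`|C| `^ r^-1)) => n le_n.
apply: le_trans (ler_norm C) _.
have {1}-> : `|C| = (`|C| `^ r^-1) `^ r by rewrite -powRrM mulVf ?powRr1 // gt_eqF.
apply: ge0_ler_powR; rewrite ?nnegrE ?powR_ge0 ?ler0n //; first exact: ltW.
apply: ltW; apply: lt_le_trans (archi_boundP (powR_ge0 _ _)) _.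
by rewrite ler_nat.
Qed.

(** With [K] about p^eps, each alternative of the flattening loses at most p^(gamma/2): the first
    contradicts non-concentration, the second |S| > p^gamma, the third |S| < p^(3 - 2 gamma). *)
Lemma nonconcentrated_energy (gamma : R) : 0 < gamma -> gamma < 1 ->
  exists2 eps : R, 0 < eps & exists p0 : nat, forall p : nat, prime p -> (p0 <= p)%N ->
  forall S : {set {'GL_2(p)}}, S \subset SL2 p ->
    p%:R `^ gamma < #|S|%:R ->
    #|S|%:R < p%:R `^ (3 - 2 * gamma) ->
    (forall (H : {group {'GL_2(p)}}) (g : {'GL_2(p)}),
       H \proper SL2 p -> g \in SL2 p ->
       #|S :&: (g *: H)%g|%:R < p%:R `^ (- (gamma / 2)) * #|S|%:R) ->
    p%:R `^ eps * (energy S)%:R <= #|S|%:R ^+ 3 :> R.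
Proof.
move=> gamma_gt0 gamma_lt1; have [c [e flat]] := energy_flattening_poly.
(* [K ^ e] is at most 2^e p^(gamma/4), and another p^(gamma/4) absorbs [c * 2 ^ e] for large p. The
   successor of [e] keeps the denominator nonzero. *)
pose eps := gamma / (4 * e.+1%:R).
have eps_gt0 : 0 < eps by rewrite divr_gt0 // mulr_gt0.
exists eps => //.
have [n0 n0P] := @ex_nat_powR (c * 2 ^ e)%N%:R (gamma / 4) ltac:(by rewrite divr_gt0).
(* From 5 on, 2 and 3 are nonzero in the field. *)
exists (maxn 5 n0) => p p_pr; rewrite geq_max => /andP[p_ge5 /n0P lep] S sS ltS Slt conc.
have p_ge1 : 1 <= p%:R :> R by rewrite ler1n prime_gt0.
have two : (2 : 'F_p) != 0 by apply: Fp_neq0; rewrite // (leq_trans _ p_ge5).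
have three : (3 : 'F_p) != 0 by apply: Fp_neq0; rewrite // (leq_trans _ p_ge5).
have cardF : #|'F_p| = p by rewrite card_Fp.
pose K := (Num.truncn (p%:R `^ eps : R)).+1.
have pe_ge1 : 1 <= p%:R `^ eps :> R by rewrite -[leLHS](powRr0 p%:R) ler_powR // ltW.
have ltK : p%:R `^ eps < K%:R :> R by apply: truncnS_gt.
have leK : K%:R <= 2 * p%:R `^ eps :> R.
  rewrite /K -natr1 mulr_natl mulr2n lerD // truncn_le.
  exact: powR_ge0.
have leT : (c * K ^ e)%N%:R <= p%:R `^ (gamma / 2) :> R.
  rewrite natrM natrX.
  apply: (@le_trans _ _ (c%:R * (2 * p%:R `^ eps) ^+ e)).
    by rewrite ler_wpM2l // lerXn2r ?nnegrE // ltW // (lt_le_trans _ leK).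
  rewrite exprMn mulrA.
  rewrite (_ : gamma / 2 = gamma / 4 + gamma / 4); last by field.
  rewrite powRD; last by rewrite implybE; apply/orP; right; rewrite pnatr_eq0 -lt0n prime_gt0.
  apply: ler_pM; rewrite ?mulr_ge0 ?exprn_ge0 ?powR_ge0 //.
    by move: lep; rewrite natrM natrX.
  rewrite powRX_nat ler_powR // /eps -mulrA (ler_wpM2l (ltW gamma_gt0)) // invfM -mulrA.
  rewrite ler_piMr ?invr_ge0 // mulrC ler_pdivrMr // mul1r ler_nat.
  exact: leqnSn.
have p_gt0 : 0 < p%:R :> R by apply: lt_le_trans p_ge1.
have S_gt0 : 0 < #|S|%:R :> R by apply: le_lt_trans ltS; exact: powR_ge0.
have S0 : S != set0 by rewrite -card_gt0 -(ltr_nat R).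
have [leE|] := leqP (#|S| ^ 3) (K * energy S); last first.
  rewrite -(ltr_nat R) natrM natrX => /ltW; apply: le_trans.
  by rewrite ler_wpM2r // ltW.
have [[H [g [Hpr gSL]]]||] := flat _ S K two three sS S0 leE.
- rewrite -(ler_nat R) natrM => le; have := conc H g Hpr gSL.
  rewrite -(ltr_pM2l (powR_gt0 (gamma / 2) p_gt0)) mulrA -powRD; last first.
    by rewrite implybE; apply/orP; right; rewrite gt_eqF.
  rewrite addrN powRr0 mul1r => lt.
  have := le_lt_trans (le_trans le (ler_wpM2r _ leT)) lt.
  by rewrite ltxx => /(_ (ler0n _ _)).
- rewrite -(ler_nat R) => le; have := lt_le_trans ltS (le_trans le leT).
  by rewrite ltNge ler_powR //; lra.
rewrite cardF -(ler_nat R) natrM natrX => le.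
have := le_lt_trans (le_trans le (ler_wpM2r (ler0n _ _) leT)) _.
have lt : p%:R `^ (gamma / 2) * #|S|%:R < p%:R `^ (gamma / 2) * p%:R `^ (3 - 2 * gamma) :> R.
  by rewrite ltr_pM2l // powR_gt0.
move=> /(_ _ lt); rewrite -powRD; last first.
  by rewrite implybE; apply/orP; right; rewrite gt_eqF.
rewrite ltNge -(powR_mulrn 3 (ltW p_gt0)) ler_powR //; lra.
Qed.

(** An incidence with y = 0 has x = 0, and the pair of zero vectors is excluded from [A] times
    [B]. *)
Lemma incidences_setD0 p (A B : {set 'cV['F_p]_2}) (S : {set {'GL_2(p)}}) :
  setX A B \subset [set~ (0, 0)] ->
  incidences (setX A B) S = incidence_count A (B :\ 0) S.
Proof.
move=> /subsetP AB0; apply: eq_card => -[[x y] g].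
apply/setIdP/setIdP=> -[/setXP[/setXP[xA yB] gS] /eqP /= e]; last first.
  case/setD1P: yB => _ yB; rewrite /= e eqxx; split=> //.
  by apply/setXP; split=> //; exact/setXP.
rewrite /= e eqxx; split=> //; apply/setXP; split=> //; apply/setXP; split=> //.
apply/setD1P; split=> //; apply/eqP=> y0.
have := AB0 (x, y); rewrite in_setX xA yB => /(_ isT).
by rewrite !inE -e y0 mulmx0 eqxx.
Qed.

End Final.

Section Final.
Variable R : realType.

Lemma incidence_energy_bound (p k : nat) (eps : R) (A B : {set 'cV['F_p]_2})
    (S : {set {'GL_2(p)}}) : prime p ->
  setX A B \subset [set~ (0, 0)] -> S \subset SL2 p ->
  p%:R `^ eps * (energy S)%:R <= #|S|%:R ^+ 3 :> R ->
  {in [set~ 0], forall y, (#|[set z in B | (cross y z == 0)%R]| <= k)%N} ->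
  (incidences (setX A B) S)%:R <=
    2 * (#|A|%:R `^ (1 / 2) * #|B|%:R * #|S|%:R / p%:R
         + k%:R `^ (1 / 4) * p%:R `^ ((1 - eps) / 4) * #|A|%:R `^ (1 / 2)
           * #|B|%:R `^ (1 / 2) * #|S|%:R `^ (3 / 4)) :> R.
Proof.
move=> p_pr AB0 sS leE lek; rewrite incidences_setD0 //.
have lek' : {in [set~ 0], forall y, (#|[set z in B :\ 0%R | (cross y z == 0)%R]| <= k)%N}.
  move=> y y0; apply: leq_trans (lek y y0); apply/subset_leq_card/subsetP=> z.
  by move=> /setIdP[/setD1P[_ zB] e]; apply/setIdP.
have B0 : 0 \notin B :\ 0 by rewrite !inE eqxx.
have := @incidence_bound 'F_p R A (B :\ 0) S k sS B0 lek'; rewrite card_Fp //.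
have leb : #|B :\ 0|%:R <= #|B|%:R :> R.
  by rewrite ler_nat; apply/subset_leq_card/subsetDl.
move: (incidence_count _ _ _) => I.
have p_gt0 : 0 < p%:R :> R by rewrite ltr0n prime_gt0.
have p_ge2 : 2 <= p%:R :> R by rewrite ler_nat prime_gt1.
set b0 : R := #|B :\ 0|%:R; set b : R := #|B|%:R; set a : R := #|A|%:R.
set s : R := #|S|%:R; set P : R := p%:R; set E : R := (energy S)%:R.
set X := b * s / P.
set al := a `^ (1 / 2).
set Y := k%:R `^ (1 / 4) * P `^ ((1 - eps) / 4) * b `^ (1 / 2) * s `^ (3 / 4).
have b_ge0 : 0 <= b by rewrite ler0n.
have b0_ge0 : 0 <= b0 by rewrite ler0n.
have s_ge0 : 0 <= s by rewrite ler0n.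
have X_ge0 : 0 <= X by rewrite divr_ge0 ?mulr_ge0 // ltW.
have Y_ge0 : 0 <= Y by rewrite !mulr_ge0 ?powR_ge0.
have al2 : al ^+ 2 = a by rewrite powR_root.
have leb2 : b0 ^+ 2 <= b ^+ 2 by rewrite lerXn2r.
(* As P >= 2, P^2 - 1 is at least half of P^2. *)
have main : s ^+ 2 * (b0 ^+ 2 / (P ^+ 2 - 1)) <= 2 * X ^+ 2.
  have P2 : 0 < P ^+ 2 - 1 by nra.
  rewrite mulrA ler_pdivrMr // /X exprMn exprVn.
  apply: (@le_trans _ _ (s ^+ 2 * b ^+ 2)); first by rewrite ler_wpM2l ?sqr_ge0.
  rewrite -[leLHS]mulr1 (_ : 2 * _ * _ = s ^+ 2 * b ^+ 2 * (2 * (P ^+ 2 - 1) / P ^+ 2)); last first.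
    by rewrite exprMn; field; rewrite gt_eqF.
  rewrite ler_wpM2l ?mulr_ge0 ?sqr_ge0 // ler_pdivlMr ?exprn_gt0 // mul1r.
  by nra.
have Y4 : Y ^+ 4 = k%:R * P `^ (1 - eps) * b ^+ 2 * s ^+ 3.
  rewrite /Y !exprMn powR_root // !powRX_nat -!(powR_mulrn _ b_ge0) -!(powR_mulrn _ s_ge0).
  by congr (_ * _ `^ _ * _ `^ _ * _ `^ _); field.
(* The energy saving enters here, and the square root of 3 is rounded up to 2. With [main] this
   gives 2 X^2 + 2 Y^2 <= 4 (X + Y)^2, hence the constant 2. *)
have err : Num.sqrt (3 * k%:R * P * b0 ^+ 2 * E) <= 2 * Y ^+ 2.
  have Y2_ge0 : 0 <= 2 * Y ^+ 2 by rewrite mulr_ge0 ?sqr_ge0.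
  rewrite -[leRHS](ger0_norm Y2_ge0) -sqrtr_sqr; apply: ler_wsqrtr.
  rewrite exprMn -exprM Y4 powRB; last by apply/implyP => _; rewrite gt_eqF.
  rewrite (powRr1 (ltW p_gt0)).
  have Pe_gt0 : 0 < P `^ eps by exact: powR_gt0.
  have leE' : E <= s ^+ 3 / P `^ eps by rewrite ler_pdivlMr // mulrC.
  have kP : 0 <= 3 * k%:R * P by rewrite !mulr_ge0 // ltW.
  apply: (@le_trans _ _ (3 * k%:R * P * b ^+ 2 * (s ^+ 3 / P `^ eps))).
    by apply: ler_pM => //; rewrite ?mulr_ge0 ?sqr_ge0 ?ler0n // ler_wpM2l.
  rewrite (_ : 2 ^+ 2 * _ = 4 * k%:R * P * b ^+ 2 * (s ^+ 3 / P `^ eps)); last first.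
    by field; rewrite gt_eqF.
  rewrite -!mulrA ler_wpM2r ?ler_nat // !mulr_ge0 ?sqr_ge0 ?exprn_ge0 ?invr_ge0 //.
  exact: ltW.
move=> leI.
have a_ge0 : 0 <= a by rewrite ler0n.
have {}leI : I%:R ^+ 2 <= (2 * (al * (X + Y))) ^+ 2.
  apply: le_trans leI _; rewrite -/a exprMn exprMn al2 mulrCA ler_wpM2l //.
  apply: le_trans (lerD main err) _.
  by nra.
have -> : 2 * (al * b * s / P
     + k%:R `^ (1 / 4) * P `^ ((1 - eps) / 4) * al * b `^ (1 / 2) * s `^ (3 / 4))
   = 2 * (al * (X + Y)) by rewrite /X /Y; field; rewrite gt_eqF.
by rewrite -ler_sqr ?nnegrE // ?mulr_ge0 ?addr_ge0 ?powR_ge0.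
Qed.
End Final.

Lemma card_cross_line (F : finFieldType) (B : {set 'cV[F]_2}) (y : 'cV[F]_2) : y != 0 ->
  (#|[set z in B | (cross y z == 0)%R]| <= #|F|)%N.
Proof.
move=> y0; rewrite -(cardsT F).
apply: leq_trans (leq_imset_card (fun c : F => c *: y) [set: F]).
apply/subset_leq_card/subsetP=> z /setIdP[_ /eqP /(cross_eq0 y0)[c ->]].
by apply/imsetP; exists c.
Qed.



Theorem theorem2p2 (R : realType) (gamma : R) (gamma_gt0 : 0 < gamma)
    (gamma_lt1 : gamma < 1) :
  exists2 eps : R, 0 < eps &
  exists2 C : R, 0 < C &
  exists p0 : nat, forall p : nat, prime p -> (p0 <= p)%N ->
  forall (A B : {set 'cV['F_p]_2}) (S : {set {'GL_2(p)}}),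
    setX A B \subset [set~ (0, 0)] ->
    S \subset SL2 p ->
    (S^-1)%g = S ->
    p%:R `^ gamma < #|S|%:R ->
    #|S|%:R < p%:R `^ (3 - 2 * gamma) ->
    (forall (H : {group {'GL_2(p)}}) (g : {'GL_2(p)}),
       H \proper SL2 p -> g \in SL2 p ->
       #|S :&: (g *: H)%g|%:R < p%:R `^ (- (gamma / 2)) * #|S|%:R) ->
    (incidences (setX A B) S)%:R <=
      C * (#|A|%:R `^ (1 / 2) * #|B|%:R * #|S|%:R / p%:R
           + p%:R `^ ((2 - eps) / 4) * #|A|%:R `^ (1 / 2)
             * #|B|%:R `^ (1 / 2) * #|S|%:R `^ (3 / 4))
    /\
    forall k : nat,
      (forall L : {vspace 'cV['F_p]_2}, \dim L = 1%N ->
         (#|[set b in B | b \in L]| <= k)%N) ->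
      (incidences (setX A B) S)%:R <=
        C * (#|A|%:R `^ (1 / 2) * #|B|%:R * #|S|%:R / p%:R
             + k%:R `^ (1 / 4) * p%:R `^ ((1 - eps) / 4) * #|A|%:R `^ (1 / 2)
               * #|B|%:R `^ (1 / 2) * #|S|%:R `^ (3 / 4)).
Proof.
have [eps eps_gt0 [p0 flat]] := nonconcentrated_energy gamma_gt0 gamma_lt1.
exists eps => //; exists 2 => //; exists p0 => p p_pr le_p A B S AB0 sS _ ltS Slt conc.
have leE := flat p p_pr le_p S sS ltS Slt conc.
have bound k := incidence_energy_bound (k := k) p_pr AB0 sS leE.
split=> [|k lek]; last first.
  apply: bound => y; rewrite !inE => y0; apply: leq_trans (lek <[y]>%VS _); last first.
    by rewrite dim_vline y0.
  apply/subset_leq_card/subsetP=> z /setIdP[zB /eqP /(cross_eq0 y0)[c e]].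
  by apply/setIdP; split=> //; rewrite e memvZ // memv_line.
(* A line has p points, so the first bound is the case k = p, the exponents 1/4 and (1 - eps)/4
   adding up. *)
have := bound p; rewrite -powRD; last first.
  by rewrite implybE pnatr_eq0 -lt0n prime_gt0 // orbT.
rewrite (_ : 1 / 4 + (1 - eps) / 4 = (2 - eps) / 4); last by field.
apply=> y; rewrite !inE => y0; have := card_cross_line B y0.
by rewrite card_Fp.
Qed.
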